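(* Let $\mathcal{Z}$ be the (labelled) class of rooted trees whose vertices are nonempty ordered sets and where there is a $\mathcal{D}_{\leq 2}$-structure over the children of every vertex. Then there is a (size-preserving) bijection $\Theta$ between $\mathcal{Z}$ and the class $\mathcal{X}\ast(\mathcal{D}\ast\mathcal{D})$, where $\mathcal{D}$ is the class of (labelled) chord diagrams. Consequently, if $Z(x)$ is the (exponential) generating series for $\mathcal{Z}$, then $$Z(x)=x\left(\frac{1}{1-I_0(x)}\right)^2,$$ where $I_0(x)$ is the generating series for nonempty indecomposable chord diagrams.
   Context: A (rooted) chord diagram of size $n\ge 0$ is a perfect matching of $\{1,\ldots,2n\}$; each pair $\{a<b\}$ is a chord. In its linear representation the points $1,\ldots,2n$ are placed left to right on a line. Two chords $\{v_1<v_2\}$ and $\{w_1<w_2\}$ cross if $v_1<w_1<v_2<w_2$ or $w_1<v_1<w_2<v_2$. The intersection graph has the chords as vertices and an edge for each crossing pair; the connected components of the diagram are the connected components of this graph. A chord diagram is indecomposable if it is not the concatenation (side by side in the linear representation) of two or more nonempty chord diagrams; the empty diagram counts as indecomposable. $I_0(x)$ is the ordinary generating function, by number of chords, of nonempty indecomposable chord diagrams. $\mathcal{D}$ is the class of all chord diagrams (including the empty one), and $\mathcal{D}_{\leq 2}$ is the class of chord diagrams with at most two connected components (including the empty diagram). Labelled setting: the atoms of a chord diagram are its chords, and a labelled object of size $n$ has its atoms labelled bijectively by $\{1,\ldots,n\}$. All $n!$ labellings of a chord diagram with $n$ chords are distinct, so the exponential generating function of labelled diagrams equals the ordinary generating function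 of unlabelled ones. $\mathcal{X}$ is the class with a single object, of size 1. $\mathcal{A}\ast\mathcal{B}$ is the usual labelled product: ordered pairs $(a,b)$ with $a$ from $\mathcal{A}$, $b$ from $\mathcal{B}$, whose labels together partition $\{1,\ldots,|a|+|b|\}$. For a labelled class $\mathcal{A}$ the exponential generating function is $A(x)=\sum_{a\in\mathcal{A}}x^{|a|}/|a|!$. For a finite set $S$ and a class $\mathcal{G}$, a $\mathcal{G}$-structure on $S$ is an arrangement of the elements of $S$ into an object of $\mathcal{G}$; thus a $\mathcal{D}_{\leq 2}$-structure on $S$ is a diagram in $\mathcal{D}_{\leq 2}$ with exactly $|S|$ chords together with a bijection from its chords to $S$. An object of $\mathcal{Z}$ of size $n$ is a rooted tree in which each vertex is a nonempty linearly ordered set of labels, the label sets of distinct vertices being disjoint with union $\{1,\ldots,n\}$, together with, for each vertex, a $\mathcal{D}_{\leq 2}$-structure on the set of its children (the empty diagram if it has no children); children carry no further order. *)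

(* Defs.v *)
From HB Require Import structures.
From mathcomp Require Import all_boot all_order all_algebra.
From mathcomp Require Import boolp.

Set Implicit Arguments.
Unset Strict Implicit.
Unset Printing Implicit Defensive.

Import GRing.Theory.

(* The points 1, ..., 2n are the elements 0, ..., 2n-1 of 'I_n.*2. *)
Definition is_diagram n (M : {set {set 'I_n.*2}}) : bool :=
  partition M [set: 'I_n.*2] && [forall c in M, #|c| == 2].

Definition diagram n : finType := {M : {set {set 'I_n.*2}} | is_diagram M}.

Definition chord n (M : diagram n) : finType := {c : {set 'I_n.*2} | c \in val M}.

Definition cross m (c d : {set 'I_m}) : bool :=
  [exists v1 : 'I_m, [exists v2 : 'I_m, [exists w1 : 'I_m, [exists w2 : 'I_m,
    [&& v1 < v2, c == [set v1; v2], w1 < w2, d == [set w1; w2]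
      & [&& v1 < w1, w1 < v2 & v2 < w2] || [&& w1 < v1, v1 < w2 & w2 < v2]]]]]].

Definition intersection_graph n (M : diagram n) : rel (chord M) :=
  fun c d => cross (val c) (val d).

Definition components n (M : diagram n) : nat :=
  n_comp (intersection_graph (M := M)) predT.

Definition point_left m n (i : 'I_m.*2) : 'I_(m + n).*2 :=
  cast_ord (esym (doubleD m n)) (lshift n.*2 i).

Definition point_right m n (i : 'I_n.*2) : 'I_(m + n).*2 :=
  cast_ord (esym (doubleD m n)) (rshift m.*2 i).

Arguments point_right m {n} i.

Definition concat_set m n (M : diagram m) (N : diagram n) :
    {set {set 'I_(m + n).*2}} :=
  [set point_left n @: c | c : {set 'I_m.*2} in val M]
  :|: [set point_right m @: c | c : {set 'I_n.*2} in val N].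

Lemma point_left_inj m n : injective (@point_left m n).
Proof. by move=> i j /(congr1 val) /= /val_inj. Qed.

Lemma point_right_inj m n : injective (@point_right m n).
Proof. by move=> i j /(congr1 val) /= /addnI /val_inj. Qed.

Lemma point_split m n (i : 'I_(m + n).*2) :
  (exists j, i = point_left n j) \/ (exists j, i = point_right m j).
Proof.
pose k := cast_ord (doubleD m n) i.
have -> : i = cast_ord (esym (doubleD m n)) k by rewrite cast_ordK.
by case: (split_ordP k) => j ->; [left | right]; exists j.
Qed.

Lemma point_left_right m n (i : 'I_m.*2) (j : 'I_n.*2) :
  point_left n i <> point_right m j.
Proof.
move=> e; have /= {}e := congr1 val e.
by have := ltn_ord i; rewrite e ltnNge leq_addr.
Qed.

Lemma concat_subproof m n (M : diagram m) (N : diagram n) :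
  is_diagram (concat_set M N).
Proof.
have /andP[/and3P[/eqP covM trM M0] /forall_inP cM] := valP M.
have /andP[/and3P[/eqP covN trN N0] /forall_inP cN] := valP N.
apply/andP; split; last first.
  apply/forall_inP => c; rewrite inE => /orP[] /imsetP[d dIn ->].
    by rewrite (card_imset _ (@point_left_inj m n)) cM.
  by rewrite (card_imset _ (@point_right_inj m n)) cN.
apply/and3P; split.
- rewrite eqEsubset subsetT /=; apply/subsetP => i _; apply/bigcupP.
  case: (point_split i) => -[j ->].
    have : j \in cover (val M) by rewrite covM inE.
    move=> /bigcupP[c cIn jc]; exists (point_left n @: c); last exact: imset_f.
    by rewrite inE; apply/orP; left; apply: imset_f.
  have : j \in cover (val N) by rewrite covN inE.
  move=> /bigcupP[c cIn jc]; exists (point_right m @: c); last exact: imset_f.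
  by rewrite inE; apply/orP; right; apply: imset_f.
- apply/trivIsetP => A B; rewrite !inE.
  have sep (c : {set 'I_m.*2}) (d : {set 'I_n.*2}) :
      [disjoint point_left n @: c & point_right m @: d].
    apply/pred0P => x /=; apply/negP => /andP[/imsetP[i _ ->]].
    by move=> /imsetP[j _] /point_left_right.
  case/orP => /imsetP[c cIn ->] /orP[] /imsetP[d dIn ->] ne.
  + rewrite imset_disjoint; last exact: point_left_inj.
    by apply: (trivIsetP trM) => //; apply: contra_neq ne => ->.
  + exact: sep.
  + by rewrite disjoint_sym; exact: sep.
  + rewrite imset_disjoint; last exact: point_right_inj.
    by apply: (trivIsetP trN) => //; apply: contra_neq ne => ->.
- rewrite inE; apply/negP => /orP[] /imsetP[c cIn] /esym/eqP.
    by rewrite imset_eq0 => /eqP c0; rewrite c0 (negPf M0) in cIn.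
  by rewrite imset_eq0 => /eqP c0; rewrite c0 (negPf N0) in cIn.
Qed.

Definition concat m n (M : diagram m) (N : diagram n) : diagram (m + n) :=
  exist (@is_diagram (m + n)) _ (concat_subproof M N).

Lemma empty_subproof : is_diagram (n := 0) set0.
Proof.
apply/andP; split; last by apply/forall_inP => c; rewrite inE.
apply/and3P; split; last by rewrite inE.
  by apply/eqP/setP => -[].
by apply/trivIsetP => A B; rewrite inE.
Qed.

Definition empty_diagram : diagram 0 := exist (@is_diagram 0) _ empty_subproof.

Definition concat_seq (s : seq {n : nat & diagram n}) : {n : nat & diagram n} :=
  foldr (fun D E => existT _ (tag D + tag E) (concat (tagged D) (tagged E)))
        (existT _ 0 empty_diagram) s.

Definition indecomposable n (M : diagram n) : Prop :=
  ~ exists s : seq {n : nat & diagram n},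
      [/\ 1 < size s, all (fun D => 0 < tag D) s
        & concat_seq s = existT _ n M].

(* A labelled class gives, for each finite set S of labels, the finite type of
   its structures on S, i.e., of its objects with label set S. *)
Definition lclass := forall T : finType, {set T} -> finType.

(* The objects labelled by {1, ..., n} are the structures on [set: 'I_n]. *)
Definition objects (A : lclass) : Type := {n : nat & A 'I_n [set: 'I_n]}.

Definition osize (A : lclass) (a : objects A) : nat := tag a.

Definition elt (T : finType) (S : {set T}) : finType := {x : T | x \in S}.

Definition atom_class : lclass := fun T S => {x : T | S == [set x]}.

Definition lprod (A B : lclass) : lclass := fun T S =>
  {S1 : {S1 : {set T} | S1 \subset S} & (A T (val S1) * B T (S :\: val S1))%type}.

Definition bijectiveb (aT rT : finType) (f : {ffun aT -> rT}) : bool :=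
  injectiveb f && [forall y, y \in codom f].

Definition diagram_class (G : forall n, pred (diagram n)) : lclass := fun T S =>
  {M : {M : diagram #|S| | G #|S| M} &
    {f : {ffun chord (val M) -> elt S} | bijectiveb f}}.

Definition D_class : lclass := diagram_class (fun n => xpredT).

Definition D_le2_class : lclass := diagram_class (fun n M => components M <= 2).

Definition is_linear_order (E : finType) (r : {set E * E}) : bool :=
  [&& [forall x, (x, x) \in r],
      [forall x, [forall y, ((x, y) \in r) && ((y, x) \in r) ==> (x == y)]],
      [forall x, [forall y, [forall z,
         ((x, y) \in r) && ((y, z) \in r) ==> ((x, z) \in r)]]]
    & [forall x, [forall y, ((x, y) \in r) || ((y, x) \in r)]]].

Definition linear_order (T : finType) (S : {set T}) : finType :=
  {r : {set elt S * elt S} | is_linear_order r}.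

(* A rooted tree with vertex set V is given by its root and its parent
   function; the root is made its own parent, and is the only vertex with this
   property since every vertex leads to it. *)
Definition is_rooted_tree (V : finType) (t : V * {ffun V -> V}) : bool :=
  (t.2 t.1 == t.1) && [forall v, fconnect t.2 v t.1].

Definition rooted_tree (V : finType) : finType :=
  {t : V * {ffun V -> V} | is_rooted_tree t}.

Definition children (V : finType) (t : rooted_tree V) (v : V) : {set V} :=
  [set u | (u != (val t).1) && ((val t).2 u == v)].

Definition Z_class : lclass := fun T S =>
  {P : {P : {set {set T}} | partition P S} &
    {t : rooted_tree (elt (val P)) &
      ({dffun forall v : elt (val P), linear_order (val v)}
       * {dffun forall v : elt (val P), D_le2_class (children t v)})%type}}.

Local Open Scope ring_scope.

Definition fps := nat -> rat.

Definition fps_one : fps := fun n => (n == 0%N)%:R.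
Definition fps_X : fps := fun n => (n == 1%N)%:R.
Definition fps_sub (f g : fps) : fps := fun n => f n - g n.
Definition fps_mul (f g : fps) : fps := fun n => \sum_(i < n.+1) f i * g (n - i)%N.

Fixpoint fps_inv_coefs (f : fps) (n : nat) : seq rat :=
  if n is m.+1 then
    let s := fps_inv_coefs f m in
    rcons s (((m == 0%N)%:R - \sum_(i < m) s`_i * f (m - i)%N) / f 0%N)
  else [::].

Definition fps_inv (f : fps) : fps := fun n => (fps_inv_coefs f n.+1)`_n.

Lemma fps_mulVf (f : fps) : f 0%N != 0 -> fps_mul (fps_inv f) f =1 fps_one.
Proof.
move=> f0; have sz n : size (fps_inv_coefs f n) = n.
  by elim: n => //= n IH; rewrite size_rcons IH.
have nthE n i : (i < n)%N -> (fps_inv_coefs f n)`_i = fps_inv f i.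
  elim: n => // n IH; rewrite ltnS leq_eqVlt => /orP[/eqP -> //|lt_in].
  by rewrite /= nth_rcons sz lt_in IH.
move=> n; rewrite /fps_mul big_ord_recr /= subnn /fps_one.
rewrite [in X in _ + X]/fps_inv /= nth_rcons sz ltnn eqxx divfK //.
rewrite [X in _ + (_ - X)](eq_bigr (fun i : 'I_n => fps_inv f i * f (n - i)%N)).
  by rewrite addrC subrK.
by move=> i _; rewrite nthE.
Qed.

Definition egf (A : lclass) : fps := fun n => #|A 'I_n [set: 'I_n]|%:R / n`!%:R.

Definition I0 : fps := fun n =>
  #|[pred M : diagram n | (0 < n)%N && `[< indecomposable M >]]|%:R.

(* Main.v *)
(* Both classes have the same number of labelled objects of every size, which
   gives the bijection; the common exponential series is T = x D^2, where D is
   the series of chord diagrams and D (1 - I0) = 1 by splitting off the first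
   indecomposable factor.

   Diagrams are counted as perfect pairings of m ordered points. Let C be the
   series of the connected ones. Removing the component of the first point
   leaves an arbitrary diagram in each gap, so D = 1 + C(x D^2); a diagram with
   two components is a connected one inserted in a gap of another one, so its
   series is 2 x C' C. With D = 1 + x D + 2 x^2 D', the chain rule gives
   F(T) = (1 - x) D^2 for the series F of the diagrams with at most two
   components, that is, T = x / (1 - x) F(T).

   On the other side, exploring a forest one root at a time shows that the trees
   with a D_{<=2}-structure on the children of every vertex have series W with
   W = x F(W), and putting nonempty ordered sets at the vertices substitutes
   x / (1 - x) for x. Hence Z = W(x / (1 - x)) is the solution T of the equation
   above. *)
From HB Require Import structures.
Require Import Defs.
From mathcomp Require Import all_boot all_order all_algebra.
From mathcomp Require Import boolp ring zify.

Set Implicit Arguments.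
Unset Strict Implicit.
Unset Printing Implicit Defensive.
Import GRing.Theory.

(** * Formal power series *)

(** Connectedness and indecomposability are one notion, [primitive rho], for two relations between
    chords, [noncross] and [before], so the removal of the block of the first point is done once for
    both. Only the shape of the complement differs: gaps in one case, a final segment in the other.
    Pairing series count points, not chords, because a gap follows each point: D = 1 + C(x D^2)
    becomes D = 1 + C(y D) with y^2 = x, and 2 x C' becomes [fps_theta]. Composition with
    [fps_X ^+ 2] is injective, so identities between series by points descend to chords. The
    differential equation comes from choosing the partner of the first point. No uniqueness theorem
    for W = x F(W) is invoked: W is defined as T(x / (1 + x)) and checked to satisfy the equation,
    and the forest count holds for every solution. Forests rather than trees are counted since
    deleting a root turns its children into roots. The bijection is not explicit: for each size, two
    finite types of equal cardinality are matched by rank. *)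

Section PowerSeriesRing.
Local Open Scope ring_scope.
Implicit Types f g h : fps.

(** Coefficient [n] of a product sees only the coefficients up to [n], so associativity and
    commutativity are borrowed from polynomials. *)
Definition fps_trunc N f : {poly rat} := \poly_(i < N) f i.

Lemma coef_fps_mul N f g n : (n < N)%N ->
  fps_mul f g n = (fps_trunc N f * fps_trunc N g)`_n.
Proof.
move=> nN; rewrite coefM; apply: eq_bigr => i _.
by rewrite !coef_poly !(leq_ltn_trans _ nN) ?leq_subr // -ltnS.
Qed.

Fact fps_mulA : associative fps_mul.
Proof.
move=> f g h; apply/funext => n.
have tr (p q : {poly rat}) (f1 g1 : fps) : (forall i, (i <= n)%N -> f1 i = p`_i) ->
    (forall i, (i <= n)%N -> g1 i = q`_i) -> fps_mul f1 g1 n = (p * q)`_n.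
  move=> Ep Eq; rewrite coefM; apply: eq_bigr => i _.
  by rewrite Ep ?Eq ?leq_subr // -ltnS.
pose t := fps_trunc n.+1.
rewrite (tr (t f) (t g * t h)) ?(tr (t f * t g) (t h)) ?mulrA // => i le_in;
  by rewrite ?coef_poly ?ltnS ?le_in // (@coef_fps_mul n.+1).
Qed.

Fact fps_mulC : commutative fps_mul.
Proof.
by move=> f g; apply/funext => n; rewrite !(@coef_fps_mul n.+1) // mulrC.
Qed.

Definition fps_add f g : fps := fun n => f n + g n.
Definition fps_opp f : fps := fun n => - f n.
Definition fps_zero : fps := fun=> 0.

Fact fps_mul1 : left_id fps_one fps_mul.
Proof.
move=> f; apply/funext => n; rewrite /fps_mul big_ord_recl big1 /= => [|i _].
  by rewrite /fps_one eqxx mul1r subn0 addr0.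
by rewrite /fps_one /= mul0r.
Qed.

Fact fps_mulDl : left_distributive fps_mul fps_add.
Proof.
move=> f g h; apply/funext => n; rewrite /fps_mul /fps_add -big_split /=.
by apply: eq_bigr => i _; rewrite mulrDl.
Qed.

Fact fps_addA : associative fps_add.
Proof. by move=> f g h; apply/funext => n; rewrite /fps_add addrA. Qed.
Fact fps_addC : commutative fps_add.
Proof. by move=> f g; apply/funext => n; rewrite /fps_add addrC. Qed.
Fact fps_add0 : left_id fps_zero fps_add.
Proof. by move=> f; apply/funext => n; rewrite /fps_add add0r. Qed.
Fact fps_addN : left_inverse fps_zero fps_opp fps_add.
Proof. by move=> f; apply/funext => n; rewrite /fps_add addNr. Qed.

End PowerSeriesRing.

HB.instance Definition _ := gen_eqMixin fps.
HB.instance Definition _ := gen_choiceMixin fps.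
HB.instance Definition _ :=
  GRing.isZmodule.Build fps fps_addA fps_addC fps_add0 fps_addN.
Fact fps_oner_neq0 : fps_one != 0%R :> fps.
Proof. by apply/eqP => /(congr1 (fun f : fps => f 0%N)). Qed.
HB.instance Definition _ := GRing.Zmodule_isComNzRing.Build fps
  fps_mulA fps_mulC fps_mul1 fps_mulDl fps_oner_neq0.

Section PowerSeries.
Local Open Scope ring_scope.
Implicit Types f g h : fps.

Lemma fpsP f g : f =1 g <-> f = g.
Proof. by split=> [/funext|->]. Qed.

Lemma coef_fpsD f g n : (f + g) n = f n + g n. Proof. by []. Qed.
Lemma coef_fpsN f n : (- f) n = - f n. Proof. by []. Qed.
Lemma coef_fpsB f g n : (f - g) n = f n - g n. Proof. by []. Qed.
Lemma coef_fps1 n : (1 : fps) n = (n == 0%N)%:R. Proof. by []. Qed.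
Lemma coef_fpsM f g n : (f * g) n = \sum_(i < n.+1) f i * g (n - i)%N.
Proof. by []. Qed.

Lemma coef_fpsXM f n : (fps_X * f) n = if n is m.+1 then f m else 0.
Proof.
rewrite coef_fpsM; case: n => [|n]; first by rewrite big_ord1 mul0r.
rewrite big_ord_recl /= mul0r add0r big_ord_recl /= mul1r subSS subn0.
by rewrite big1 ?addr0 // => i _; rewrite mul0r.
Qed.

(** The valuation bound that makes the truncated sums in a composition exact. *)
Lemma coef_fpsX_lt g k n : g 0%N = 0 -> (n < k)%N -> (g ^+ k) n = 0.
Proof.
move=> g0; elim: k n => // k IH n; rewrite ltnS => le_nk.
rewrite exprS coef_fpsM big_ord_recl /= g0 mul0r add0r big1 // => i _.
rewrite IH ?mulr0 //= /bump /=; case: n le_nk i => [|n] le_nk i; first by case: i.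
by rewrite subSS (leq_ltn_trans (leq_subr _ _)).
Qed.

(* Meaningful only when [g 0 = 0]: the sum defining the coefficient is then
   the truncation of an infinite sum whose other terms vanish. *)
Definition fps_comp f g : fps := fun n => \sum_(k < n.+1) f k * (g ^+ k) n.

(** Any cutoff beyond [n] gives the same value, so coefficients of different degrees can share one
    cutoff and their sums can be exchanged. *)
Lemma fps_compE N f g n : g 0%N = 0 -> (n < N)%N ->
  fps_comp f g n = \sum_(k < N) f k * (g ^+ k) n.
Proof.
move=> g0 nN; rewrite /fps_comp (big_ord_widen N (fun k => f k * (g ^+ k) n)) //.
rewrite big_mkcond; apply: eq_bigr => k _; case: ltnP => // le_nk.
by rewrite coef_fpsX_lt ?mulr0.
Qed.

(** Both sides collect the terms f_i h_j g^(i+j): one over the triangle i + j <= n, the other over a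
    square whose excess has valuation above n. *)
Lemma fps_compM f h g : g 0%N = 0 ->
  fps_comp (f * h) g = fps_comp f g * fps_comp h g.
Proof.
move=> g0; apply/fpsP => n; rewrite coef_fpsM (fps_compE _ g0 (ltnSn n)).
have -> : \sum_(i < n.+1) fps_comp f g i * fps_comp h g (n - i)%N =
    \sum_(i < n.+1) \sum_(j < n.+1) f i * h j * (g ^+ (i + j)) n.
  transitivity (\sum_(a < n.+1) \sum_(i < n.+1) \sum_(j < n.+1)
      f i * h j * ((g ^+ i) a * (g ^+ j) (n - a)%N)).
    apply: eq_bigr => a _; rewrite !(@fps_compE n.+1) // ?ltnS ?leq_subr //.
    rewrite mulr_suml; apply: eq_bigr => i _; rewrite mulr_sumr.
    by apply: eq_bigr => j _; ring.
  rewrite exchange_big; apply: eq_bigr => i _ /=.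
  rewrite exchange_big; apply: eq_bigr => j _ /=.
  by rewrite exprD coef_fpsM mulr_sumr.
under eq_bigr => k _ do rewrite coef_fpsM mulr_suml.
pose G i k := if (i <= k)%N then f i * h (k - i)%N * (g ^+ k) n else 0.
transitivity (\sum_(k < n.+1) \sum_(i < n.+1) G i k).
  apply: eq_bigr => k _.
  rewrite (big_ord_widen n.+1 (fun i => f i * h (k - i)%N * (g ^+ k) n)) //.
  by rewrite big_mkcond.
rewrite exchange_big; apply: eq_bigr => i _ /=.
rewrite -(big_mkord xpredT (G i)) (big_cat_nat (n := i)) //=; last exact: ltnW.
rewrite big_nat big1 ?add0r => [|k /andP[_ lt_ki]]; last by rewrite /G leqNgt lt_ki.
rewrite -{1}[i : nat]add0n big_addn big_mkord.
rewrite [RHS](bigID (fun j : 'I_n.+1 => (j < n.+1 - i)%N)) /=.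
rewrite [X in _ = _ + X]big1 ?addr0 => [|j]; last first.
  by rewrite -leqNgt leq_subLR => lt_nij; rewrite coef_fpsX_lt ?mulr0.
rewrite -(big_ord_widen n.+1 (fun j => f i * h j * (g ^+ (i + j)) n)) ?leq_subr //.
by apply: eq_bigr => j _; rewrite /G leq_addl addnK addnC.
Qed.

Lemma fps_compD f h g : fps_comp (f + h) g = fps_comp f g + fps_comp h g.
Proof.
apply/fpsP => n; rewrite coef_fpsD /fps_comp -big_split.
by apply: eq_bigr => k _; rewrite coef_fpsD mulrDl.
Qed.

Lemma fps_comp1 g : fps_comp 1 g = 1.
Proof.
apply/fpsP => n; rewrite /fps_comp big_ord_recl big1 ?addr0 => [|i _].
  by rewrite expr0 coef_fps1 mul1r.
by rewrite coef_fps1 mul0r.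
Qed.

Lemma fps_compN f g : fps_comp (- f) g = - fps_comp f g.
Proof.
apply/fpsP => n; rewrite coef_fpsN /fps_comp -sumrN.
by apply: eq_bigr => k _; rewrite coef_fpsN mulNr.
Qed.

Lemma fps_compXe f g k : g 0%N = 0 -> fps_comp (f ^+ k) g = fps_comp f g ^+ k.
Proof.
move=> g0; elim: k => [|k IH]; first by rewrite !expr0 fps_comp1.
by rewrite !exprS fps_compM // IH.
Qed.

Lemma fps_compX g : g 0%N = 0 -> fps_comp fps_X g = g.
Proof.
move=> g0; apply/fpsP => n; rewrite (@fps_compE n.+2) // !big_ord_recl /=.
rewrite big1 => [|i _]; last by rewrite mul0r.
by rewrite mul0r add0r expr1 mul1r addr0.
Qed.

Lemma fps_X_exp k n : (fps_X ^+ k) n = (n == k)%:R.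
Proof.
by elim: k n => [|k IH] [|n] //; rewrite exprS coef_fpsXM // IH.
Qed.

Lemma fps_compfX f : fps_comp f fps_X = f.
Proof.
apply/fpsP => n; rewrite /fps_comp big_ord_recr /= fps_X_exp eqxx mulr1.
rewrite big1 ?add0r // => i _; rewrite fps_X_exp gtn_eqF ?mulr0 //.
Qed.

Lemma coef0_fps_comp f g : fps_comp f g 0%N = f 0%N.
Proof. by rewrite /fps_comp big_ord1 expr0 coef_fps1 mulr1. Qed.

Lemma coef0_fpsM f g : (f * g) 0%N = f 0%N * g 0%N.
Proof. by rewrite coef_fpsM big_ord1. Qed.

Lemma fps_compA f g h : g 0%N = 0 -> h 0%N = 0 ->
  fps_comp (fps_comp f g) h = fps_comp f (fps_comp g h).
Proof.
move=> g0 h0; apply/fpsP => n; rewrite (fps_compE _ h0 (ltnSn n)).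
rewrite (@fps_compE n.+1) // ?coef0_fps_comp //.
transitivity (\sum_(k < n.+1) \sum_(j < n.+1) f j * (g ^+ j) k * (h ^+ k) n).
  by apply: eq_bigr => k _; rewrite (@fps_compE n.+1) // mulr_suml.
rewrite exchange_big; apply: eq_bigr => j _ /=; rewrite -fps_compXe //.
by rewrite (fps_compE _ h0 (ltnSn n)) mulr_sumr; apply: eq_bigr => k _; rewrite mulrA.
Qed.

(** The Euler operator x d/dx. It shifts no index, and on series by points it marks a point. *)
Definition fps_theta f : fps := fun n => n%:R * f n.

Lemma fps_thetaM f g : fps_theta (f * g) = fps_theta f * g + f * fps_theta g.
Proof.
apply/fpsP => n; rewrite coef_fpsD /fps_theta !coef_fpsM mulr_sumr -big_split /=.
apply: eq_bigr => i _; rewrite -{1}(subnKC (_ : i <= n)%N) -1?ltnS // natrD.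
by ring.
Qed.

Lemma fps_thetaB f g : fps_theta (f - g) = fps_theta f - fps_theta g.
Proof. by apply/fpsP => n; rewrite coef_fpsB /fps_theta mulrBr. Qed.

Lemma fps_theta1 : fps_theta 1 = 0.
Proof. by apply/fpsP => -[|n]; rewrite /fps_theta ?mul0r // mulr0. Qed.

Lemma fps_thetaX : fps_theta fps_X = fps_X.
Proof. by apply/fpsP => -[|[|n]]; rewrite /fps_theta ?mul0r ?mul1r // mulr0. Qed.

Lemma fps_theta_exp g k : fps_theta (g ^+ k) * g = k%:R * (g ^+ k * fps_theta g).
Proof.
elim: k => [|k IH]; first by rewrite expr0 fps_theta1 !mul0r.
by rewrite exprS fps_thetaM mulrDl -[_ * _ * g in X in _ + X]mulrA IH -natr1; ring.
Qed.

Lemma coef_fps_natM k f n : (k%:R * f) n = k%:R * f n.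
Proof. by rewrite !mulr_natl; elim: k => // k IH; rewrite !mulrS coef_fpsD IH. Qed.

(** The chain rule for x d/dx, cleared of the denominator [g]: composing [fps_theta f] with g yields
    g f'(g), where x f'(g) would be wanted. *)
Lemma fps_theta_comp f g : g 0%N = 0 ->
  fps_theta (fps_comp f g) * g = fps_comp (fps_theta f) g * fps_theta g.
Proof.
move=> g0; apply/fpsP => n; rewrite !coef_fpsM.
transitivity (\sum_(k < n.+1) f k * (fps_theta (g ^+ k) * g) n).
  under [RHS]eq_bigr => k _ do rewrite coef_fpsM mulr_sumr.
  rewrite exchange_big; apply: eq_bigr => i _ /=.
  rewrite /fps_theta (@fps_compE n.+1) // mulr_sumr mulr_suml.
  by apply: eq_bigr => k _; ring.
transitivity (\sum_(k < n.+1) fps_theta f k * (g ^+ k * fps_theta g) n).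
  by apply: eq_bigr => k _; rewrite fps_theta_exp coef_fps_natM /fps_theta; ring.
under eq_bigr => k _ do rewrite coef_fpsM mulr_sumr.
rewrite exchange_big; apply: eq_bigr => i _ /=.
by rewrite (@fps_compE n.+1) // mulr_suml; apply: eq_bigr => k _; rewrite mulrA.
Qed.

End PowerSeries.

(** * Pairings of finite sets *)

(* Locked, lest [inE] expand the membership predicate of [pairings]. *)
HB.lock Definition pairings (T : finType) (S : {set T}) : {set {set {set T}}} :=
  [set N : {set {set T}} | partition N S && [forall c in N, #|c| == 2]].

Lemma mem_pairings (T : finType) (S : {set T}) (N : {set {set T}}) :
  (N \in pairings S) = partition N S && [forall c in N, #|c| == 2].
Proof. by rewrite pairings.unlock inE. Qed.

Lemma pairingsP (T : finType) (S : {set T}) (N : {set {set T}}) : reflect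
  [/\ cover N = S, forall c d x, c \in N -> d \in N -> x \in c -> x \in d -> c = d
    & forall c, c \in N -> #|c| = 2] (N \in pairings S).
Proof.
rewrite mem_pairings; apply: (iffP andP) => [[/and3P[/eqP covN trN N0] /forall_inP cN]|].
  split=> // [c d x cN' dN xc xd|c /cN/eqP //].
  by rewrite -(def_pblock trN cN' xc) (def_pblock trN dN xd).
case=> covN uN cN; split; last by apply/forall_inP => c /cN ->.
apply/and3P; split; first by rewrite covN.
  apply/trivIsetP => c d cN' dN; apply: contra_neqT => /pred0Pn[x /andP[xc xd]].
  exact: (uN _ _ x).
by apply/negP => /cN; rewrite cards0.
Qed.

Lemma card_pairings_points (T : finType) (S : {set T}) (N : {set {set T}}) :
  N \in pairings S -> #|S| = #|N|.*2.
Proof.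
rewrite mem_pairings => /andP[/card_partition -> /forall_inP cN].
by rewrite (eq_bigr (fun=> 2)) ?sum_nat_const ?muln2 // => c /cN/eqP.
Qed.

Lemma setUDl (T : finType) (A B : {set T}) : [disjoint A & B] -> (A :|: B) :\: A = B.
Proof.
move=> dis; rewrite setDUl setDv set0U; apply/setDidPl.
by rewrite disjoint_sym.
Qed.

Section Pairings.
Variable T : finType.
Implicit Types (S A B : {set T}) (N K L : {set {set T}}) (c d : {set T}).

Lemma pairings_sub S N K : N \in pairings S -> K \subset N ->
  K \in pairings (cover K).
Proof.
case/pairingsP => _ uN cN /subsetP sKN; apply/pairingsP; split=> // [c d x|c].
  by move=> /sKN cN' /sKN; apply: uN.
by move/sKN/cN.
Qed.

Lemma coverU N K : cover (N :|: K) = cover N :|: cover K.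
Proof. exact: bigcup_setU. Qed.

Lemma cover_pairingsD S N K : N \in pairings S -> K \subset N ->
  cover (N :\: K) = S :\: cover K.
Proof.
case/pairingsP => <- uN cN /subsetP sKN; apply/setP => x; rewrite in_setD.
apply/bigcupP/andP => [[c]|[xK /bigcupP[c cN' xc]]].
  rewrite inE => /andP[cK cN'] xc; split; last by apply/bigcupP; exists c.
  apply: contra cK => /bigcupP[d dK xd].
  by rewrite (uN c d x) // sKN.
exists c; rewrite // inE cN' andbT; apply: contra xK => cK.
by apply/bigcupP; exists c.
Qed.

Lemma pairingsD S N K : N \in pairings S -> K \subset N ->
  N :\: K \in pairings (S :\: cover K).
Proof.
move=> pN sKN; rewrite -(cover_pairingsD pN sKN).
exact: pairings_sub pN (subsetDl _ _).
Qed.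

Lemma pairingsU S1 S2 N1 N2 : [disjoint S1 & S2] ->
  N1 \in pairings S1 -> N2 \in pairings S2 -> N1 :|: N2 \in pairings (S1 :|: S2).
Proof.
move=> dis /pairingsP[cov1 u1 c1] /pairingsP[cov2 u2 c2]; apply/pairingsP.
split=> [|c d x|c]; first by rewrite coverU cov1 cov2.
  have in1 e : e \in N1 -> x \in e -> x \in S1.
    by move=> eN xe; rewrite -cov1; apply/bigcupP; exists e.
  have in2 e : e \in N2 -> x \in e -> x \in S2.
    by move=> eN xe; rewrite -cov2; apply/bigcupP; exists e.
  rewrite !inE => /orP[] cN /orP[] dN xc xd.
  - exact: (u1 _ _ x).
  - by have := disjointFr dis (in1 _ cN xc); rewrite (in2 _ dN xd).
  - by have := disjointFr dis (in1 _ dN xd); rewrite (in2 _ cN xc).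
  - exact: (u2 _ _ x).
by rewrite inE => /orP[/c1|/c2].
Qed.

Lemma pairings_chord_sub S N c : N \in pairings S -> c \in N -> c \subset S.
Proof.
by case/pairingsP => <- _ _ cN; apply/subsetP => x xc; apply/bigcupP; exists c.
Qed.

Lemma pairings_neq0 S N c : N \in pairings S -> c \in N -> c != set0.
Proof. by case/pairingsP => _ _ cN /cN c2; rewrite -card_gt0 c2. Qed.

Lemma pairings_cover S N : N \in pairings S -> cover N = S.
Proof. by case/pairingsP. Qed.

Lemma pairings_disjoint S1 S2 N1 N2 : [disjoint S1 & S2] ->
  N1 \in pairings S1 -> N2 \in pairings S2 -> [disjoint N1 & N2].
Proof.
move=> dis p1 p2; apply/pred0P => c /=; apply/negP => /andP[c1 c2].
have /set0Pn[x xc] := pairings_neq0 p1 c1.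
have := disjointFr dis (subsetP (pairings_chord_sub p1 c1) x xc).
by rewrite (subsetP (pairings_chord_sub p2 c2) x xc).
Qed.

(** Chords are nonempty, so a chord of the union shows by its points which part it comes from, and
    the union map is injective. *)
Lemma card_pairingsU S1 S2 (X1 X2 : {set {set {set T}}}) : [disjoint S1 & S2] ->
  X1 \subset pairings S1 -> X2 \subset pairings S2 ->
  #|[set N1 :|: N2 | N1 in X1, N2 in X2]| = #|X1| * #|X2|.
Proof.
move=> dis /subsetP s1 /subsetP s2; rewrite curry_imset2X card_in_imset ?cardsX //.
have dis' : [disjoint S2 & S1] by rewrite disjoint_sym.
have key (K1 K2 : {set {set T}}) (R1 R2 : {set T}) c : [disjoint R1 & R2] -> K1 \in pairings R1 ->
  K2 \in pairings R2 -> c \in K1 -> (c \notin K2).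
  by move=> d12 p1 p2 c1; rewrite (disjointFr (pairings_disjoint d12 p1 p2)).
move=> [N1 N2] [N1' N2']; rewrite !inE /= => /andP[a1 a2] /andP[b1 b2] eU.
have := s1 _ a1; have := s2 _ a2; have := s1 _ b1; have := s2 _ b2 => pb2 pb1 pa2 pa1.
have {eU}eU c : (c \in N1) || (c \in N2) = (c \in N1') || (c \in N2').
  by have /setP/(_ c) := eU; rewrite !inE.
congr (_, _); apply/setP => c; apply/idP/idP => cN; have := eU c; rewrite cN ?orbT /=.
- by move=> /esym; rewrite (negPf (key _ _ _ _ c dis pa1 pb2 cN)) orbF.
- by rewrite (negPf (key _ _ _ _ c dis pb1 pa2 cN)) orbF.
- by move=> /esym; rewrite (negPf (key _ _ _ _ c dis' pa2 pb1 cN)).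
- by rewrite (negPf (key _ _ _ _ c dis' pb2 pa1 cN)).
Qed.

(** * Separated subsets and primitive pairings *)

Section Primitive.
Variable rho : rel {set T}.

(** With [noncross], a separated set is a union of connected components; with [before], it is a set
    of chords preceding all the others. The primitive pairings are then the nonempty connected ones
    and the nonempty indecomposable ones. *)
Definition separated N K :=
  (K \subset N) && [forall c in K, forall d in N :\: K, rho c d].

Definition primitive N :=
  (N != set0) && [forall K : {set {set T}}, separated N K ==> (K == set0) || (K == N)].

Lemma separatedP N K : reflect
  (K \subset N /\ forall c d, c \in K -> d \in N -> d \notin K -> rho c d)
  (separated N K).
Proof.
apply: (iffP andP) => -[sKN sep]; split=> //; [move=> c d cK dN dK|].
  by have /forall_inP/(_ c cK)/forall_inP/(_ d) := sep; rewrite inE dK dN; apply.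
by apply/forall_inP => c cK; apply/forall_inP => d /setDP[dN dK]; apply: sep.
Qed.

Lemma primitiveP N : reflect
  (N != set0 /\ forall K, separated N K -> K = set0 \/ K = N) (primitive N).
Proof.
apply: (iffP andP) => -[N0 pN]; split=> //; [move=> K sK|].
  by have /forallP/(_ K) := pN; rewrite sK => /orP[]/eqP; [left | right].
by apply/forallP => K; apply/implyP => /pN[]->; rewrite eqxx ?orbT.
Qed.

Lemma separatedI N K K' : separated N K -> separated N K' -> separated N (K :&: K').
Proof.
move=> /separatedP[sK hK] /separatedP[sK' hK']; apply/separatedP; split.
  exact: subset_trans (subsetIl _ _) sK.
move=> c d /setIP[cK cK'] dN; rewrite inE negb_and => /orP[]; first exact: hK.
exact: hK'.
Qed.

Lemma separatedW N K L : separated N K -> L \subset N -> separated L (K :&: L).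
Proof.
move=> /separatedP[_ hK] /subsetP sL; apply/separatedP; rewrite subsetIr; split=> //.
move=> c d /setIP[cK _] dL; rewrite inE dL andbT; exact/hK/sL.
Qed.

Lemma separated_trans N K L : separated N K -> separated K L -> separated N L.
Proof.
move=> /separatedP[sK hK] /separatedP[sL hL]; apply/separatedP.
split=> [|c d cL dN dL]; first exact: subset_trans sL sK.
have [dK|dK] := boolP (d \in K); first exact: hL.
by apply: hK => //; apply: (subsetP sL).
Qed.

(** [K :&: K'] is separated in each of the two sets and contains [c], so it equals both. *)
Lemma primitive_inj N K K' c : separated N K -> separated N K' ->
  primitive K -> primitive K' -> c \in K -> c \in K' -> K = K'.
Proof.
move=> sK sK' /primitiveP[_ pK] /primitiveP[_ pK'] cK cK'.
have ne : K :&: K' != set0 by apply/set0Pn; exists c; rewrite inE cK.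
have /separatedP[sKN _] := sK; have /separatedP[sKN' _] := sK'.
have [e|e] := pK _ (separatedW sK' sKN); first by rewrite setIC e eqxx in ne.
have [e'|e'] := pK' _ (separatedW sK sKN'); first by rewrite e' eqxx in ne.
by rewrite -e setIC e'.
Qed.

(** A smallest separated set containing [c] is primitive. The relation [before] is not symmetric, so
    complements of separated sets need not be separated; the hypothesis supplies what is used about
    the sets that miss [c]. *)
Lemma primitive_exists N c : c \in N ->
  (forall K, separated N K -> c \notin K -> K = set0 \/ separated N (N :\: K)) ->
  exists K, [/\ separated N K, primitive K & c \in K].
Proof.
move=> cN hc.
have sNN : separated N N && (c \in N).
  by rewrite cN andbT; apply/separatedP; split=> // d e _ ->.
have [K /andP[sK cK] minK] := @arg_minnP _ N
  (fun K : {set {set T}} => separated N K && (c \in K)) (fun K => #|K|) sNN.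
exists K; split=> //; apply/primitiveP; split=> [|L sLK]; first by apply/set0Pn; exists c.
have [sL _] := separatedP _ _ sLK.
have sLN := separated_trans sK sLK.
have [cL|cL] := boolP (c \in L).
  by right; apply/eqP; rewrite eqEcard sL minK // sLN.
(* Removing [L] from [K] leaves a separated set that still contains [c]; by minimality it is no
   smaller than [K], so [L] is empty. *)
left; have [//|sNL] := hc L sLN cL.
have cKL : c \in K :&: (N :\: L) by rewrite !inE cK cL cN.
have /minK : separated N (K :&: (N :\: L)) && (c \in K :&: (N :\: L)).
  by rewrite separatedI.
have [sKN _] := separatedP _ _ sK.
have -> : K :&: (N :\: L) = K :\: L.
  by rewrite setIDA; congr (_ :\: _); apply/setIidPl.
rewrite -{1}(cardsID L K) (setIidPr sL) -[X in _ <= X]add0n leq_add2r leqn0 cards_eq0.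
by move/eqP.
Qed.

End Primitive.
End Pairings.

(** * Invariance under increasing relabelling of the points *)

Section Transfer.
Variables (T T' : finType) (f : T -> T').
Hypothesis f_inj : injective f.
Implicit Types (S : {set T}) (N K : {set {set T}}).

Definition map_chords N : {set {set T'}} := [set f @: c | c : {set T} in N].

Lemma map_chords_inj : injective map_chords.
Proof. exact/imset_inj/imset_inj. Qed.

Lemma mem_map_chords N (c : {set T}) : (f @: c \in map_chords N) = (c \in N).
Proof. by rewrite mem_imset //; apply: imset_inj. Qed.

Lemma map_chords_pairings S N : (map_chords N \in pairings (f @: S)) = (N \in pairings S).
Proof.
apply/pairingsP/pairingsP => -[cov u card2].
  split=> [|c d x cN dN xc xd|c cN]; last first.
  - by rewrite -(card_imset _ f_inj) card2 ?mem_map_chords.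
  - by apply: (imset_inj f_inj); apply: (u _ _ (f x)); rewrite ?mem_map_chords ?imset_f.
  apply: (imset_inj f_inj); rewrite -cov /cover; apply/setP => y.
  apply/imsetP/bigcupP => [[x /bigcupP[c cN xc] ->]|[_ /imsetP[c cN ->] /imsetP[x xc ->]]].
    by exists (f @: c); rewrite ?mem_map_chords ?imset_f.
  by exists x => //; apply/bigcupP; exists c.
split=> [|_ _ _ /imsetP[c cN ->] /imsetP[d dN ->] /imsetP[x xc ->]|_ /imsetP[c cN ->]].
- rewrite -cov; apply/setP => y.
  apply/bigcupP/imsetP => [[_ /imsetP[c cN ->] /imsetP[x xc ->]]|[x /bigcupP[c cN xc] ->]].
    by exists x => //; apply/bigcupP; exists c.
  by exists (f @: c); rewrite ?mem_map_chords ?imset_f.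
- by rewrite mem_imset // => xd; rewrite (u c d x).
- by rewrite card_imset // card2.
Qed.

Lemma pairings_imset S : pairings (f @: S) = map_chords @: pairings S.
Proof.
apply/setP => N'; apply/idP/imsetP => [pN'|[N pN ->]]; last by rewrite map_chords_pairings.
have N'E : N' = map_chords [set f @^-1: c | c : {set T'} in N'].
  have fK (c : {set T'}) : c \in N' -> f @: (f @^-1: c) = c.
    move=> cN'; apply/setP => y; apply/imsetP/idP => [[x]|yc]; first by rewrite inE => ? ->.
    have /imsetP[x _ ey] := subsetP (pairings_chord_sub pN' cN') y yc.
    by exists x; rewrite // inE -ey.
  apply/setP => c; apply/idP/imsetP => [cN'|[_ /imsetP[d dN' ->] ->]]; last by rewrite fK.
  by exists (f @^-1: c); rewrite ?fK // imset_f.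
by exists [set f @^-1: c | c : {set T'} in N']; rewrite // -map_chords_pairings -N'E.
Qed.

Lemma primitive_map_chords (rho : rel {set T}) (rho' : rel {set T'}) N :
  (forall c d : {set T}, rho' (f @: c) (f @: d) = rho c d) ->
  primitive rho' (map_chords N) = primitive rho N.
Proof.
move=> rhoE.
have sepE K : separated rho' (map_chords N) (map_chords K) = separated rho N K.
  apply/separatedP/separatedP => -[/subsetP sK hK]; split.
  - by apply/subsetP => c cK; rewrite -mem_map_chords sK ?mem_map_chords.
  - by move=> c d cK dN dK; rewrite -rhoE hK ?mem_map_chords.
  - by apply/subsetP => _ /imsetP[c cK ->]; rewrite mem_map_chords sK.
  - move=> _ _ /imsetP[c cK ->] /imsetP[d dN ->].
    by rewrite mem_map_chords rhoE; apply: hK.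
have map0 K : (map_chords K == set0) = (K == set0) by rewrite imset_eq0.
apply/primitiveP/primitiveP => -[N0 pN]; split; rewrite ?map0 // -?map0 // => K sK.
  have [/eqP|/map_chords_inj] := pN (map_chords K) (etrans (sepE K) sK).
    by rewrite map0 => /eqP; left.
  by right.
have KE : K = map_chords [set c : {set T} | f @: c \in K].
  have [sKN _] := separatedP _ _ _ sK.
  apply/setP => c; apply/idP/imsetP => [cK|[d]]; last by rewrite inE => dK ->.
  have /imsetP[d _ ec] := subsetP sKN c cK.
  by exists d; rewrite // inE -ec.
move: sK; rewrite KE sepE => /pN[->|->]; last by right.
by left; apply/eqP; rewrite map0.
Qed.

End Transfer.

(** [enum] filters the increasing list of all points. Hence counts that depend only on the order of
    the points depend only on the size of the subset. *)
Lemma enum_val_mono m (S : {set 'I_m}) (i j : 'I_#|S|) :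
  (enum_val i < enum_val j) = (i < j).
Proof.
have srt : sorted ltn (map val (enum S)).
  rewrite /enum_mem; apply: (@subseq_sorted _ ltn ltn_trans _ (iota 0 m)); last exact: iota_ltn_sorted.
  by rewrite -val_enum_ord map_subseq // enumT filter_subseq.
have mono (a b : 'I_#|S|) : a < b -> enum_val a < enum_val b.
  have valE (k : 'I_#|S|) : enum_val k = nth 0 (map val (enum S)) k :> nat.
    by rewrite (nth_map (enum_val k)) -?cardE // -enum_val_nth.
  by move=> lt_ab; rewrite !valE (sorted_ltn_nth ltn_trans) // inE size_map -cardE.
case: (ltngtP i j) => [/mono//|/mono lt_ji|/val_inj ->]; last exact: ltnn.
by apply/negbTE; rewrite -leqNgt ltnW.
Qed.

Lemma imset_enum_val (T : finType) (S : {set T}) :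
  [set @enum_val T (mem S) i | i in [set: 'I_#|S|]] = S.
Proof.
apply/setP => x; apply/imsetP/idP => [[i _ ->]|xS]; first exact: enum_valP.
by exists (enum_rank_in xS x); rewrite ?enum_rankK_in.
Qed.

Definition npairings m := #|pairings [set: 'I_m]|.

Lemma card_pairings (T : finType) (S : {set T}) : #|pairings S| = npairings #|S|.
Proof.
rewrite -{1}(imset_enum_val S) pairings_imset; last exact: enum_val_inj.
by rewrite card_imset //; apply/map_chords_inj/enum_val_inj.
Qed.

Definition chord_rel := forall m, rel {set 'I_m}.

Definition order_invariant (rho : chord_rel) :=
  forall k m (f : 'I_k -> 'I_m), (forall i j, (f i < f j) = (i < j)) ->
  forall c d : {set 'I_k}, rho m (f @: c) (f @: d) = rho k c d.

Definition primitives (rho : chord_rel) m (S : {set 'I_m}) :=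
  [set N in pairings S | primitive (@rho m) N].

Definition nprimitives rho m := #|primitives rho [set: 'I_m]|.

Lemma card_primitives rho m (S : {set 'I_m}) : order_invariant rho ->
  #|primitives rho S| = nprimitives rho #|S|.
Proof.
move=> inv; have mono := @enum_val_mono m S.
have inj : injective (@enum_val _ (mem S)) by apply: enum_val_inj.
rewrite /nprimitives -[RHS](card_imset _ (map_chords_inj inj)); apply: eq_card => N.
rewrite inE -{1}(imset_enum_val S) pairings_imset //.
apply/andP/imsetP => [[/imsetP[N' pN' ->]]|[N' + ->]].
  by rewrite (primitive_map_chords inj _ (inv _ _ _ mono)) => prN; exists N'; rewrite // inE pN'.
by rewrite inE (primitive_map_chords inj _ (inv _ _ _ mono)) => /andP[pN' ->]; rewrite imset_f.
Qed.

(** * The two relations between chords *)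

Definition noncross : chord_rel := fun m c d => ~~ cross c d.

Definition before : chord_rel := fun m c d => [forall x in c, forall y in d, x < y].

(** The inequalities [v1 < v2] and [w1 < w2] are dropped, as each interleaving implies them. *)
Lemma crossP m (c d : {set 'I_m}) : reflect
  (exists v1 v2 w1 w2 : 'I_m, [/\ c = [set v1; v2], d = [set w1; w2]
    & [&& v1 < w1, w1 < v2 & v2 < w2] || [&& w1 < v1, v1 < w2 & w2 < v2]])
  (cross c d).
Proof.
apply: (iffP existsP) => [[v1 /existsP[v2 /existsP[w1 /existsP[w2 h]]]]|].
  case/and5P: h => _ /eqP cE _ /eqP dE h.
  by exists v1, v2, w1, w2.
case=> v1 [v2 [w1 [w2 [-> -> h]]]]; exists v1; apply/existsP; exists v2.
apply/existsP; exists w1; apply/existsP; exists w2; rewrite !eqxx h !andbT /=.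
by apply/andP; split; lia.
Qed.

Lemma cross_sym m (c d : {set 'I_m}) : cross c d = cross d c.
Proof.
by apply/crossP/crossP => -[v1 [v2 [w1 [w2 [-> -> h]]]]]; exists w1, w2, v1, v2;
  split=> //; rewrite orbC.
Qed.

Lemma eq_set2 m (a b p q : 'I_m) : a < b -> p < q ->
  [set a; b] = [set p; q] -> a = p /\ b = q.
Proof.
move=> ab pq /setP e.
have ha := e a; have hb := e b; rewrite !inE !eqxx ?orbT /= in ha hb.
move: (esym ha) (esym hb) => /orP[]/eqP a_ /orP[]/eqP b_; subst => //; lia.
Qed.

Lemma cross2 m (a b p q : 'I_m) : a < b -> p < q ->
  cross [set a; b] [set p; q] =
    [&& a < p, p < b & b < q] || [&& p < a, a < q & q < b].
Proof.
move=> ab pq; apply/crossP/idP => [[v1 [v2 [w1 [w2 [e1 e2 h]]]]]|h]; last first.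
  by exists a, b, p, q.
have [|-> ->] := eq_set2 ab _ e1; first by lia.
by have [|-> ->] := eq_set2 pq _ e2; first by lia.
Qed.

Lemma set2_of_card m (c : {set 'I_m}) : #|c| = 2 ->
  exists a b : 'I_m, a < b /\ c = [set a; b].
Proof.
move/eqP/cards2P => [a [b [ab ->]]]; case: (ltngtP a b) => [lt_ab|lt_ba|/val_inj e].
- by exists a, b.
- by exists b, a; rewrite setUC.
- by rewrite e eqxx in ab.
Qed.

Lemma noncross_invariant : order_invariant noncross.
Proof.
move=> k m f mono c d; congr negb.
have inj : injective f.
  by move=> i j e; case: (ltngtP i j) => [||/val_inj//]; rewrite -mono e ltnn.
have im2 (a b : 'I_k) : f @: [set a; b] = [set f a; f b] by rewrite imsetU1 imset_set1.
apply/crossP/crossP => [[v1 [v2 [w1 [w2 [ec ed h]]]]]|[v1 [v2 [w1 [w2 [-> -> h]]]]]]; last first.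
  by exists (f v1), (f v2), (f w1), (f w2); rewrite !im2 !mono.
have : v1 \in f @: c by rewrite ec !inE eqxx.
have : v2 \in f @: c by rewrite ec !inE eqxx orbT.
have : w1 \in f @: d by rewrite ed !inE eqxx.
have : w2 \in f @: d by rewrite ed !inE eqxx orbT.
move=> /imsetP[b2 _ e4] /imsetP[b1 _ e3] /imsetP[a2 _ e2] /imsetP[a1 _ e1]; subst.
rewrite !mono in h; exists a1, a2, b1, b2; split=> //.
  by apply: (imset_inj inj); rewrite im2.
by apply: (imset_inj inj); rewrite im2.
Qed.

Lemma beforeP m (c d : {set 'I_m}) :
  reflect (forall x y, x \in c -> y \in d -> x < y) (before c d).
Proof.
apply: (iffP forall_inP) => [h x y xc yd|h x xc].
  by have /forall_inP := h x xc; apply.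
by apply/forall_inP => y; apply: h.
Qed.

Lemma before_invariant : order_invariant before.
Proof.
move=> k m f mono c d; apply/beforeP/beforeP => h.
  by move=> x y xc yd; rewrite -mono h ?imset_f.
by move=> _ _ /imsetP[x xc ->] /imsetP[y yd ->]; rewrite mono h.
Qed.

(** * Splitting off the block of a given point *)

Section RootDecomposition.
Variables (T : finType) (rho : rel {set T}) (x0 : T) (Q : pred {set {set T}}).
Implicit Types (A : {set T}) (N K : {set {set T}}).

(** [p.1] plays the block of [x0], on the points [A], and [p.2] the rest. [Q] is trivial when all
    pairings are counted, and primitivity when those with two components are. *)
Definition root_pairs A : {set {set {set T}} * {set {set T}}} :=
  [set p | [&& p.1 \in pairings A, p.2 \in pairings (~: A), primitive rho p.1, Q p.2
    & [forall c in p.1, forall d in p.2, rho c d]]].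

(** Two candidate blocks covering [x0] share the chord through [x0], so [primitive_inj] makes the
    block unique and [N] corresponds to a single pair. *)
Lemma card_root_decomposition :
  #|[set N in pairings [set: T] | [exists K : {set {set T}},
      [&& separated rho N K, primitive rho K, x0 \in cover K & Q (N :\: K)]]]|
  = \sum_(A : {set T} | x0 \in A) #|root_pairs A|.
Proof.
pose B := [set p | (x0 \in cover p.1) && (p \in root_pairs (cover p.1))].
have BE p : (p \in B) = (x0 \in cover p.1) && (p \in root_pairs (cover p.1)).
  by rewrite inE.
transitivity #|B|; last first.
  rewrite -sum1_card (partition_big (fun p => cover p.1) (fun A => x0 \in A)) /=; last first.
    by move=> p; rewrite BE => /andP[].
  apply: eq_bigr => A x0A; rewrite -[RHS]sum1_card; apply: eq_bigl => p.
  rewrite BE; apply/andP/idP => [[/andP[_ +] /eqP e]|pA]; first by rewrite e.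
  have e : cover p.1 = A by move: pA; rewrite inE => /andP[/pairings_cover].
  by rewrite e x0A pA.
have sepU p : p \in root_pairs (cover p.1) -> separated rho (p.1 :|: p.2) p.1.
  rewrite inE => /and5P[p1 p2 pr q /forall_inP h].
  apply/separatedP; split=> [|c d c1]; first exact: subsetUl.
  by rewrite inE => /orP[->//|d2] _; have /forall_inP := h c c1; apply.
have disC A : [disjoint A & ~: A] by rewrite -setI_eq0 setICr.
rewrite -(@card_in_imset _ _ (fun p => p.1 :|: p.2) B) => [|p p']; last first.
  rewrite !BE => /andP[x0p pp] /andP[x0p' pp'] e.
  have := sepU _ pp; have := sepU _ pp'; rewrite -e => s' s.
  move: pp pp'; rewrite !inE => /and5P[p1 p2 pr _ _] /and5P[p1' p2' pr' _ _].
  have [c c1 x0c] := bigcupP x0p; have [c' c1' x0c'] := bigcupP x0p'.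
  have pU := pairingsU (disC _) p1 p2; rewrite setUCr in pU.
  have e1 : p.1 = p'.1.
    apply: (primitive_inj s s' pr pr' c1).
    have cU : c \in p.1 :|: p.2 by rewrite inE c1.
    have cU' : c' \in p.1 :|: p.2 by rewrite e inE c1'.
    by have /pairingsP[_ u _] := pU; rewrite (u c c' x0).
  rewrite [p]surjective_pairing [p']surjective_pairing e1; congr (_, _).
  rewrite -(setUDl (pairings_disjoint (disC _) p1 p2)) e.
  by rewrite e1 setUDl // (pairings_disjoint (disC _) p1' p2').
apply: eq_card => N; rewrite inE; apply/andP/imsetP => [[pN /existsP[K]]|[p pB ->]].
  case/and4P=> sK pK x0K qK; have [sKN _] := separatedP _ _ _ sK.
  exists (K, N :\: K) => /=; last first.
    by rewrite setDE setUIr setUCr setIT; apply/esym/setUidPr.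
  rewrite BE inE /= x0K pK qK (pairings_sub pN) // -setTD (pairingsD pN) //=.
  by have /andP[_] := sK.
move: (pB); rewrite BE => /andP[x0p pp]; have s := sepU _ pp.
move: pp; rewrite inE => /and5P[p1 p2 pr q _].
have pU := pairingsU (disC _) p1 p2; rewrite setUCr in pU; split=> //.
apply/existsP; exists p.1; rewrite s pr x0p setUDl //.
exact: pairings_disjoint (disC _) p1 p2.
Qed.

End RootDecomposition.

(** * Positions of a block and of its complement *)

Section Compatibility.
Variable m : nat.
Implicit Types (A B S : {set 'I_m}) (N K : {set {set 'I_m}}).

(** For chords off [A]: each one stays within a single gap between points of [A]. *)
Definition avoids A N := [forall d in N, forall w1 in d, forall w2 in d,
  forall x in A, ~~ ((w1 < x) && (x < w2))].

Lemma avoidsP A N : reflect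
  (forall (d : {set 'I_m}) (w1 w2 x : 'I_m), d \in N -> w1 \in d -> w2 \in d -> x \in A ->
    w1 < x -> x < w2 -> False)
  (avoids A N).
Proof.
apply: (iffP forall_inP) => [h d w1 w2 x dN w1d w2d xA lt1 lt2|h d dN].
  have /forall_inP/(_ _ w1d)/forall_inP/(_ _ w2d)/forall_inP/(_ _ xA) := h d dN.
  by rewrite lt1 lt2.
apply/forall_inP => w1 w1d; apply/forall_inP => w2 w2d; apply/forall_inP => x xA.
by apply/negP => /andP[]; apply: h dN w1d w2d xA.
Qed.

Definition convex B := [forall a in B, forall b in B, forall x : 'I_m,
  (a < x) && (x < b) ==> (x \in B)].

Lemma convexP B : reflect
  (forall a b x : 'I_m, a \in B -> b \in B -> a < x -> x < b -> x \in B) (convex B).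
Proof.
apply: (iffP forall_inP) => [h a b x aB bB ltax ltxb|h a aB].
  by have /forall_inP/(_ _ bB)/forallP/(_ x) := h a aB; rewrite ltax ltxb.
by apply/forall_inP => b bB; apply/forallP => x; apply/implyP => /andP[]; apply: h.
Qed.

Lemma cross_between (c d : {set 'I_m}) : cross c d ->
  exists v1 v2 u, [/\ v1 \in c, v2 \in c, u \in d, v1 < u & u < v2].
Proof.
case/crossP => v1 [v2 [w1 [w2 [-> -> /orP[]/and3P[h1 h2 h3]]]]].
  by exists v1, v2, w1; rewrite !inE !eqxx ?orbT.
by exists v1, v2, w2; rewrite !inE !eqxx ?orbT.
Qed.

(* A connected set of chords that does not cross a chord [d] lies either strictly
   between the endpoints of [d] or outside them; the former is impossible here,
   as [A] contains the point 0. *)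
Lemma noncross_avoids A N1 N2 (x0 : 'I_m) : x0 = 0 :> nat -> x0 \in A ->
  N1 \in pairings A -> N2 \in pairings (~: A) -> primitive (@noncross m) N1 ->
  [forall c in N1, forall d in N2, noncross c d] = avoids A N2.
Proof.
move=> x00 x0A p1 p2 /primitiveP[_ pr].
have [cov1 u1 card1] := pairingsP _ _ p1.
have [cov2 u2 card2] := pairingsP _ _ p2.
have in1 (c : {set 'I_m}) x : c \in N1 -> x \in c -> x \in A.
  by move=> /(pairings_chord_sub p1)/subsetP; apply.
have in2 (c : {set 'I_m}) x : c \in N2 -> x \in c -> x \notin A.
  by move=> /(pairings_chord_sub p2)/subsetP h /h; rewrite inE.
apply/idP/avoidsP => [ncr d w1 w2 x dN2 w1d w2d xA lt1 lt2|av].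
  have dE : d = [set w1; w2].
    apply/eqP; rewrite eq_sym eqEcard cards2 (card2 _ dN2); apply/andP; split.
      by apply/subsetP => z; rewrite !inE => /orP[]/eqP->.
    by rewrite -val_eqE /= neq_ltn (ltn_trans lt1 lt2).
  pose I := [set y : 'I_m | (w1 < y) && (y < w2)].
  have HI (e : {set 'I_m}) u : e \in N1 -> u \in e -> u \in I -> e \subset I.
    move=> eN1 ue; rewrite inE => /andP[l1 l2]; apply/subsetP => y ye.
    have /forall_inP/(_ _ eN1)/forall_inP/(_ _ dN2) := ncr; rewrite /noncross dE.
    have [a [b [ab eE]]] := set2_of_card (card1 _ eN1).
    have aw1 : (a != w1 :> nat).
      by apply/negP => /eqP/val_inj E; have := in2 _ _ dN2 w1d; rewrite -E (in1 e) // eE !inE eqxx.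
    have aw2 : (a != w2 :> nat).
      by apply/negP => /eqP/val_inj E; have := in2 _ _ dN2 w2d; rewrite -E (in1 e) // eE !inE eqxx.
    have bw1 : (b != w1 :> nat).
      by apply/negP => /eqP/val_inj E; have := in2 _ _ dN2 w1d; rewrite -E (in1 e) // eE !inE eqxx orbT.
    have bw2 : (b != w2 :> nat).
      by apply/negP => /eqP/val_inj E; have := in2 _ _ dN2 w2d; rewrite -E (in1 e) // eE !inE eqxx orbT.
    rewrite eE cross2 //; last exact: ltn_trans lt1 lt2.
    by move: ue ye; rewrite eE !inE => /orP[]/eqP ? /orP[]/eqP ?; subst; lia.
  pose K := [set c in N1 | c \subset I].
  have sK : separated (@noncross m) N1 K.
    apply/separatedP; split; first by apply/subsetP => c; rewrite inE => /andP[].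
    move=> c e.
    rewrite !inE => /andP[cN1 /subsetP cI] eN1; rewrite eN1 /= => eI.
    apply/negP => /cross_between[v1 [v2 [u [/cI v1I /cI v2I ue l1 l2]]]].
    move/negP: eI; apply; apply: (HI e u) => //.
    by move: v1I v2I; rewrite !inE; lia.
  have [c cN1 xc] : exists2 c, c \in N1 & x \in c by apply/bigcupP; rewrite -/(cover N1) cov1.
  have [K0|KN] := pr K sK.
    have : c \in K by rewrite inE cN1 (HI c x) // inE lt1.
    by rewrite K0 inE.
  have [c0 c0N1 x0c0] : exists2 c, c \in N1 & x0 \in c.
    by apply/bigcupP; rewrite -/(cover N1) cov1.
  have : c0 \in K by rewrite KN.
  by rewrite inE => /andP[_ /subsetP/(_ _ x0c0)]; rewrite inE x00.
apply/forall_inP => c cN1; apply/forall_inP => d dN2; rewrite /noncross cross_sym.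
apply/negP => /cross_between[v1 [v2 [u [v1d v2d uc l1 l2]]]].
exact: av dN2 v1d v2d (in1 _ _ cN1 uc) l1 l2.
Qed.

(** If a point [x] of [A] lay between two points of the complement, the chords to the left of [x]
    would form a nonempty proper separated subset of the connected [N2]. *)
Lemma connected_avoids A N2 : N2 \in pairings (~: A) ->
  primitive (@noncross m) N2 -> avoids A N2 = convex (~: A).
Proof.
move=> p2 /primitiveP[_ pr]; have [cov2 _ _] := pairingsP _ _ p2.
have in2 (c : {set 'I_m}) x : c \in N2 -> x \in c -> x \notin A.
  by move=> /(pairings_chord_sub p2)/subsetP h /h; rewrite inE.
apply/avoidsP/convexP => [av a b x aB bB ltax ltxb|cvx d w1 w2 x dN w1d w2d xA l1 l2].
  rewrite inE; apply/negP => xA.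
  have below (c : {set 'I_m}) y z : c \in N2 -> y \in c -> z \in c -> y < x -> z < x.
    move=> cN yc zc ltyx; rewrite ltnNge leq_eqVlt; apply/negP => /orP[/eqP/val_inj xz|].
      by have := in2 _ _ cN zc; rewrite -xz xA.
    exact: av cN yc zc xA ltyx.
  pose K := [set c in N2 | [forall y in c, y < x]].
  have sK : separated (@noncross m) N2 K.
    apply/separatedP; split; first by apply/subsetP => c; rewrite inE => /andP[].
    move=> c e.
    rewrite !inE => /andP[cN /forall_inP cx] eN; rewrite eN /= => ex.
    apply/negP => /cross_between[v1 [v2 [u [/cx v1x /cx v2x ue l1 l2]]]].
    move/negP: ex; apply; apply/forall_inP => y ye; apply: (below e u) => //.
    exact: ltn_trans l2 v2x.
  have mem2 y : y \in ~: A -> exists2 c, c \in N2 & y \in c.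
    by move=> yB; apply/bigcupP; rewrite -/(cover N2) cov2.
  have [c cN ac] := mem2 _ aB; have [d dN bd] := mem2 _ bB.
  have [K0|KN] := pr K sK.
    have : c \in K by rewrite inE cN; apply/forall_inP => y yc; apply: below ac yc ltax.
    by rewrite K0 inE.
  have : d \in K by rewrite KN.
  by rewrite inE => /andP[_ /forall_inP/(_ _ bd)]; rewrite ltnNge ltnW.
have : x \in ~: A by apply: cvx l1 l2; rewrite inE; apply: in2 dN _.
by rewrite inE xA.
Qed.

Lemma before_initial A N1 N2 : N1 \in pairings A -> N2 \in pairings (~: A) ->
  [forall c in N1, forall d in N2, before c d]
  = [forall x in A, forall y in ~: A, x < y].
Proof.
move=> p1 p2; have [cov1 _ _] := pairingsP _ _ p1; have [cov2 _ _] := pairingsP _ _ p2.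
apply/forall_inP/forall_inP => [h x|h c cN1].
  rewrite -{1}cov1 => /bigcupP[c cN1 xc]; apply/forall_inP => y.
  rewrite -cov2 => /bigcupP[d dN2 yd].
  by have /forall_inP/(_ _ dN2)/beforeP := h c cN1; apply.
apply/forall_inP => d dN2; apply/beforeP => x y xc yd.
have /h/forall_inP : x \in A by rewrite -cov1; apply/bigcupP; exists c.
by apply; rewrite -cov2; apply/bigcupP; exists d.
Qed.

End Compatibility.

(** * Recurrences for the numbers of pairings *)

Definition nconnected m := nprimitives noncross m.
Definition nindec m := nprimitives before m.

Lemma npairings0 : npairings 0 = 1.
Proof.
rewrite /npairings; suff -> : pairings [set: 'I_0] = [set set0] by rewrite cards1.
apply/setP => N; rewrite inE; apply/idP/eqP => [pN|->].
  apply/setP => c; rewrite inE; apply/negP => cN.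
  by have /set0Pn[[]] := pairings_neq0 pN cN.
apply/pairingsP; split=> [|c d x|c]; rewrite ?inE //.
by apply/setP => -[].
Qed.

Lemma npairings_odd m : odd m -> npairings m = 0.
Proof.
move=> m_odd; apply/eqP; rewrite cards_eq0; apply/eqP/setP => N; rewrite [RHS]inE.
apply/negP => /card_pairings_points; rewrite cardsT card_ord => e.
by rewrite e odd_double in m_odd.
Qed.

Lemma nprimitives_le rho m : nprimitives rho m <= npairings m.
Proof. by apply: subset_leq_card; apply/subsetP => N; rewrite inE => /andP[]. Qed.

Lemma nprimitives0 rho : nprimitives rho 0 = 0.
Proof.
apply/eqP; rewrite cards_eq0; apply/eqP/setP => N; rewrite [RHS]inE.
apply/negP; rewrite inE => /andP[pN /primitiveP[/set0Pn[c cN] _]].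
by have /set0Pn[[]] := pairings_neq0 pN cN.
Qed.

Lemma cardsTC m (A : {set 'I_m}) : #|~: A| = m - #|A|.
Proof. by rewrite cardsCs setCK card_ord. Qed.

(** The point 0 has [m.+1] possible partners, and the other [m] points are paired freely. *)
Lemma npairingsSS m : npairings m.+2 = m.+1 * npairings m.
Proof.
pose has_chord (j : 'I_m.+2) := [set N in pairings [set: 'I_m.+2] | [set ord0; j] \in N].
have card_hc (j : 'I_m.+2) : j != ord0 -> #|has_chord j| = npairings m.
  move=> j0; pose A : {set 'I_m.+2} := [set ord0; j].
  have cA : #|A| = 2 by rewrite cards2 eq_sym j0.
  have pA : [set A] \in pairings A.
    apply/pairingsP; split=> [|c d x|c]; rewrite ?inE.
    - by rewrite /cover big_set1.
    - by move=> /eqP-> /eqP->.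
    - by move/eqP->.
  have disj : [disjoint A & ~: A] by rewrite -setI_eq0 setICr.
  have -> : has_chord j = [set N1 :|: N2 | N1 in [set [set A]], N2 in pairings (~: A)].
    apply/setP => N; rewrite inE; apply/andP/imset2P => [[pN AN]|[_ N2 /set1P-> p2 ->]].
      have sAN : [set A] \subset N by rewrite sub1set.
      exists [set A] (N :\: [set A]); first by rewrite inE.
        by have := pairingsD pN sAN; rewrite (pairings_cover pA) setTD.
      by rewrite setDE setUIr setUCr setIT; apply/esym/setUidPr.
    have := pairingsU disj pA p2; rewrite setUCr => pN; split=> //.
    by rewrite !inE eqxx.
  rewrite (card_pairingsU disj) ?sub1set // cards1 mul1n card_pairings cardsTC cA.
  by rewrite subSS subn1.
have -> : npairings m.+2 = \sum_(j : 'I_m.+2 | j != ord0) #|has_chord j|.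
  rewrite /npairings -sum1_card.
  (* Exactly one [j], the partner of 0 in [N], contributes 1 to the inner sum. *)
  transitivity (\sum_(N in pairings [set: 'I_m.+2])
      \sum_(j : 'I_m.+2 | j != ord0) (N \in has_chord j)).
    apply: eq_bigr => N pN; have [cov u card2] := pairingsP _ _ pN.
    have [c cN c0] : exists2 c, c \in N & ord0 \in c.
      by apply/bigcupP; rewrite -/(cover N) cov inE.
    have [a [b [ab cE]]] := set2_of_card (card2 _ cN).
    have a0 : a = ord0.
      by move: c0; rewrite cE !inE => /orP[]/eqP e; apply: val_inj => /=; rewrite -?e // in ab *.
    subst a; have b0 : b != ord0 by rewrite -val_eqE /= -lt0n.
    rewrite (bigD1 b) //= inE pN -cE cN big1 // => j /andP[j0 jb].
    rewrite inE pN /=; apply/eqP; rewrite eqb0; apply: contra jb => jN.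
    have h0 : ord0 \in [set ord0; j] by rewrite !inE eqxx.
    have : j \in c by rewrite -(u _ _ _ jN cN h0 c0) !inE eqxx orbT.
    by rewrite cE !inE (negPf j0).
  rewrite exchange_big; apply: eq_bigr => j _ /=; rewrite -sum1_card.
  rewrite [LHS]big_mkcond [RHS]big_mkcond; apply: eq_bigr => N _.
  by rewrite inE; case: (N \in pairings _) => //=; case: (_ \in N).
rewrite (eq_bigr (fun=> npairings m)) // sum_nat_const; congr (_ * _).
by rewrite cardC1 card_ord.
Qed.

Lemma noncross_sym m (c d : {set 'I_m}) : noncross c d = noncross d c.
Proof. by rewrite /noncross cross_sym. Qed.

Lemma separated_noncrossD m (N K : {set {set 'I_m}}) :
  separated (@noncross m) N K -> separated (@noncross m) N (N :\: K).
Proof.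
move=> /separatedP[sK hK]; apply/separatedP; split=> [|c d]; first exact: subsetDl.
rewrite !inE => /andP[cK cN] dN; rewrite dN andbT negbK => dK.
by rewrite noncross_sym; apply: hK.
Qed.

(** The hypothesis of [primitive_exists] at the chord of the first point. It holds for [noncross] by
    symmetry, and for [before] because no point precedes 0. *)
Definition root_separable (rho : chord_rel) := forall m (N K : {set {set 'I_m.+1}}) c,
  N \in pairings [set: 'I_m.+1] -> c \in N -> ord0 \in c ->
  separated (@rho m.+1) N K -> c \notin K -> K = set0 \/ separated (@rho m.+1) N (N :\: K).

Lemma noncross_separable : root_separable noncross.
Proof. by move=> m N K c _ _ _ sK _; right; apply: separated_noncrossD. Qed.

Lemma before_separable : root_separable before.
Proof.
move=> m N K c pN cN c0 /separatedP[/subsetP sK hK] cK; left; apply/setP => d.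
rewrite inE; apply/negP => dK; have /set0Pn[x xd] := pairings_neq0 pN (sK d dK).
by have /beforeP/(_ x ord0 xd c0) := hK _ _ dK cN cK.
Qed.

Lemma npairings_root rho m : root_separable rho ->
  npairings m.+1 = \sum_(A : {set 'I_m.+1} | ord0 \in A) #|root_pairs (@rho m.+1) xpredT A|.
Proof.
move=> sep; rewrite -card_root_decomposition; apply: eq_card => N.
rewrite inE; apply/idP/andP => [pN|[]//]; split=> //; have [cov _ _] := pairingsP _ _ pN.
have [c cN c0] : exists2 c, c \in N & ord0 \in c.
  by apply/bigcupP; rewrite -/(cover N) cov inE.
have [K [sK pK cK]] := primitive_exists cN (fun K => @sep m N K c pN cN c0).
apply/existsP; exists K; rewrite sK pK /= andbT.
by apply/bigcupP; exists c.
Qed.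

Definition prefix_set m q : {set 'I_m} := [set x : 'I_m | x < q].

Lemma card_prefix_set m q : q <= m -> #|prefix_set m q| = q.
Proof.
by move=> qm; rewrite -sum1dep_card -(big_ord_widen m (fun=> 1)) // sum1_card card_ord.
Qed.

Lemma initial_prefix m (A : {set 'I_m}) :
  [forall x in A, forall y in ~: A, x < y] = (A == prefix_set m #|A|).
Proof.
apply/forall_inP/eqP => [ini|-> x]; last first.
  by rewrite inE => xA; apply/forall_inP => y; rewrite !inE -leqNgt; apply: leq_trans.
apply/setP => x; rewrite inE; apply/idP/idP => [xA|]; last apply: contraTT => xA.
  rewrite -(@card_prefix_set m x.+1) //; apply/subset_leq_card/subsetP => y; rewrite inE ltnS.
  apply: contraTT => yA; rewrite -ltnNge.
  by have /forall_inP := ini x xA; apply; rewrite inE.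
rewrite -leqNgt -[X in _ <= X](@card_prefix_set m x) ?(ltnW (ltn_ord x)) //.
apply/subset_leq_card/subsetP => y yA; rewrite inE.
by have /forall_inP := ini y yA; apply; rewrite inE.
Qed.

(** For [before], the points of the first block form an initial segment, so the sum over blocks
    collapses to a sum over their sizes [p.+1]. *)
Lemma npairings_indec m :
  npairings m.+1 = \sum_(p < m.+1) nindec p.+1 * npairings (m - p).
Proof.
rewrite (npairings_root _ before_separable).
have cP (p : 'I_m.+1) : #|prefix_set m.+1 p.+1| = p.+1 by rewrite card_prefix_set.
transitivity (\sum_(A : {set 'I_m.+1} | (ord0 \in A) && (A == prefix_set m.+1 #|A|))
    nindec #|A| * npairings (m.+1 - #|A|)).
  rewrite big_mkcondr; apply: eq_bigr => A A0; rewrite -initial_prefix.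
  case: ifP => ini; last first.
    apply/eqP; rewrite cards_eq0; apply/eqP/setP => p; rewrite [RHS]inE inE.
    by apply/negP => /and5P[p1 p2 _ _]; rewrite (before_initial p1 p2) ini.
  rewrite -cardsTC /nindec -(card_primitives _ before_invariant) -card_pairings -cardsX.
  apply: eq_card => -[N1 N2]; rewrite !inE /=.
  have [p1|] //= := boolP (N1 \in pairings A).
  have [p2|] := boolP (N2 \in pairings (~: A)); last by rewrite andbF.
  by rewrite (before_initial p1 p2) ini !andbT.
rewrite (reindex_onto (fun p : 'I_m.+1 => prefix_set m.+1 p.+1) (fun A => inord #|A|.-1)).
  apply: eq_big => [p|p _]; rewrite cP ?subSS //.
  by rewrite eqxx inE /= inord_val eqxx.
move=> A /andP[A0 /eqP AE].
have cA : 0 < #|A| by apply/card_gt0P; exists ord0.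
have leA : #|A| <= m.+1 by rewrite -[X in _ <= X](card_ord m.+1) max_card.
by rewrite [RHS]AE inordK ?prednK.
Qed.

Definition two_connected m (N : {set {set 'I_m}}) :=
  [exists K : {set {set 'I_m}}, [&& separated (@noncross m) N K,
    primitive (@noncross m) K & primitive (@noncross m) (N :\: K)]].

Definition ntwo_connected m := #|[set N in pairings [set: 'I_m] | two_connected N]|.

(** As [noncross] is symmetric, [K] and its complement can be exchanged; fixing the one that
    contains 0 will count each pairing once. *)
Lemma two_connected_root m (N : {set {set 'I_m.+1}}) : N \in pairings [set: 'I_m.+1] ->
  two_connected N = [exists K : {set {set 'I_m.+1}}, [&& separated (@noncross m.+1) N K,
    primitive (@noncross m.+1) K, ord0 \in cover K
    & primitive (@noncross m.+1) (N :\: K)]].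
Proof.
move=> pN; apply/existsP/existsP => -[K]; last first.
  by case/and4P=> sK pK _ pNK; exists K; rewrite sK pK.
case/and3P=> sK pK pNK; have [sKN _] := separatedP _ _ _ sK.
have [K0|K0] := boolP (ord0 \in cover K); first by exists K; rewrite sK pK K0.
exists (N :\: K); rewrite separated_noncrossD // pNK (cover_pairingsD pN) // !inE K0 /=.
by rewrite setDDr setDv set0U (setIidPr sKN).
Qed.

(** The component without the point 0 fills an interval of [l] points, which may start anywhere from
    1 to [m - l]; hence the factor. The term [l = 0] vanishes with [nconnected 0]. *)
Lemma ntwo_connectedE m :
  ntwo_connected m = \sum_(l < m) (m - l) * nconnected (m - l) * nconnected l.
Proof.
case: m => [|m].
  rewrite big_ord0; apply/eqP; rewrite cards_eq0; apply/eqP/setP => N; rewrite [RHS]inE inE.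
  apply/negP => /andP[pN /existsP[K /and3P[/separatedP[/subsetP sK _]]]].
  case/primitiveP => /set0Pn[c /sK cN] _ _.
  by have /set0Pn[[]] := pairings_neq0 pN cN.
transitivity (\sum_(A : {set 'I_m.+1} | ord0 \in A)
    #|root_pairs (@noncross m.+1) (primitive (@noncross m.+1)) A|).
  rewrite -card_root_decomposition; apply: eq_card => N; rewrite !inE.
  by have [pN|] //= := boolP (N \in _); rewrite two_connected_root.
(* An interval is coded by its start and its length; both are positive, as it avoids 0 and is
   nonempty. *)
pose interval (j : 'I_m.+1 * 'I_m.+1) := [set x : 'I_m.+1 | (j.1 <= x) && (x < j.1 + j.2)].
pose J := [set j : 'I_m.+1 * 'I_m.+1 | [&& 0 < j.1, 0 < j.2 & j.1 + j.2 <= m.+1]].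
pose F (B : {set 'I_m.+1}) := nconnected (m.+1 - #|B|) * nconnected #|B|.
have card_int j : j \in J -> #|interval j| = j.2.
  rewrite inE => /and3P[_ _ le].
  have -> : interval j = prefix_set m.+1 (j.1 + j.2) :\: prefix_set m.+1 j.1.
    by apply/setP => x; rewrite !inE -leqNgt.
  rewrite cardsD (setIidPr _) ?card_prefix_set ?addKn //; first exact: ltnW.
  by apply/subsetP => x; rewrite !inE => lt; apply: leq_trans lt (leq_addr _ _).
have int_inj : {in J &, injective interval}.
  move=> [p l] [p' l'] jJ jJ' e.
  have el : l = l'.
    by apply: val_inj; rewrite /= -(card_int (p, l) jJ) -(card_int (p', l') jJ') e.
  subst l'; move: jJ jJ'; rewrite !inE /= => /and3P[p0 l0 le] /and3P[p'0 _ le'].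
  congr (_, _); apply: val_inj => /=.
  have /setP e1 := e; have := e1 p; have := e1 p'; rewrite !inE /=; lia.
transitivity (\sum_(B in interval @: J) F B).
  transitivity (\sum_(B : {set 'I_m.+1} | (ord0 \notin B) && convex B) F B); last first.
    rewrite big_mkcond [RHS]big_mkcond; apply: eq_bigr => B _.
    (* The empty set is convex but is no interval coded in [J]; its weight is 0. *)
    have [->|/set0Pn[b bB]] := eqVneq B set0.
      have -> : F set0 = 0 by rewrite /F cards0 /nconnected nprimitives0 muln0.
      by do 2 case: ifP.
    suff -> : (ord0 \notin B) && convex B = (B \in interval @: J) by [].
    apply/andP/imsetP => [[B0 /convexP cvx]|[[p l] jJ ->]]; last first.
      move: jJ; rewrite !inE /= => /and3P[p0 l0 le]; split; first by lia.
      by apply/convexP => a c x; rewrite !inE /=; lia.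
    have [p pB minp] := @arg_minnP _ b (fun x => x \in B) (fun x => x) bB.
    have [q qB maxq] := @arg_maxnP _ b (fun x => x \in B) (fun x => x) bB.
    have pq : p <= q := minp _ qB.
    have p0 : 0 < p by rewrite lt0n; apply: contraNneq B0 => p0; rewrite -(_ : p = ord0) //; apply: val_inj.
    have lq : (q - p).+1 < m.+1 by have := ltn_ord q; lia.
    exists (p, Ordinal lq); first by rewrite inE /= p0 /=; have := ltn_ord q; lia.
    apply/setP => x; rewrite inE /=; apply/idP/idP => [xB|/andP[px xq]].
      by rewrite minp //=; have := maxq _ xB; lia.
    have [xp|xp] := eqVneq (x : nat) p; first by rewrite (val_inj xp).
    have [xq'|xq'] := eqVneq (x : nat) q; first by rewrite (val_inj xq').
    by apply: (cvx p q x) => //; lia.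
  rewrite [RHS](reindex_onto (fun A => ~: A) (fun A => ~: A)) => [|A _]; last exact: setCK.
  rewrite big_mkcond [RHS]big_mkcond; apply: eq_bigr => A _.
  rewrite setCK eqxx andbT in_setC negbK; case: ifP => A0 //=.
  have E (N1 N2 : {set {set 'I_m.+1}}) : N1 \in pairings A -> N2 \in pairings (~: A) ->
      primitive (@noncross m.+1) N1 -> primitive (@noncross m.+1) N2 ->
      [forall c in N1, forall d in N2, noncross c d] = convex (~: A).
    move=> p1 p2 pr1 pr2.
    by rewrite (@noncross_avoids _ A N1 N2 ord0) // connected_avoids.
  case: ifP => cvx; last first.
    apply/eqP; rewrite cards_eq0; apply/eqP/setP => p; rewrite [RHS]inE inE.
    by apply/negP => /and5P[p1 p2 pr1 pr2]; rewrite E // cvx.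
  have -> : F (~: A) = nconnected #|A| * nconnected #|~: A|.
    by rewrite /F -(cardsTC (~: A)) setCK.
  rewrite /nconnected -2!(card_primitives _ noncross_invariant) -cardsX.
  apply: eq_card => -[N1 N2]; rewrite !inE /=.
  have [p1|] //= := boolP (N1 \in pairings A).
  have [p2|] := boolP (N2 \in pairings (~: A)); last by rewrite andbF.
  have [pr1|] //= := boolP (primitive _ N1).
  by have [pr2|] //= := boolP (primitive _ N2); rewrite E.
rewrite big_imset //=.
rewrite (eq_bigr (fun j : 'I_m.+1 * 'I_m.+1 => nconnected (m.+1 - j.2) * nconnected j.2)); last first.
  by move=> j jJ; rewrite /F card_int.
rewrite (eq_bigl (fun j : 'I_m.+1 * 'I_m.+1 =>
    true && [&& 0 < j.1, 0 < j.2 & j.1 + j.2 <= m.+1])); last by move=> j; rewrite inE.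
rewrite -(pair_big_dep xpredT (fun p l : 'I_m.+1 => [&& 0 < p, 0 < l & p + l <= m.+1])
  (fun _ l => nconnected (m.+1 - l) * nconnected l)) /=.
rewrite (exchange_big_dep xpredT) //=; apply: eq_bigr => l _.
rewrite sum_nat_const -mulnA.
have [l0|l0] := posnP l; first by rewrite l0 /nconnected nprimitives0 !muln0.
congr (_ * _).
(* The admissible starts are 1, ..., [m.+1 - l]. *)
have -> : m.+1 - l = #|prefix_set m.+1 (m.+1 - l).+1 :\: prefix_set m.+1 1|.
  rewrite cardsD (setIidPr _) ?card_prefix_set //; try lia.
  by apply/subsetP => x; rewrite !inE; lia.
by apply: eq_card => p; rewrite !inE; lia.
Qed.

(** * Filling the gaps of the first component *)

Section Gaps.
Variable m : nat.
Notation prefix := (prefix_set m.+1).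
Implicit Types (A : {set 'I_m.+1}) (N : {set {set 'I_m.+1}}).

(** Restricting to the first [q] points allows a recursion on the largest point of [A]. *)
Definition gap_pairings q A := [set N in pairings (prefix q :\: A) | avoids A N].

(** No chord straddles [p] and no point of [A] lies after it: the points after [p] are paired
    freely, those before it as for [A] alone. *)
Lemma card_gap_pairingsU1 q (p : 'I_m.+1) A : p < q -> q <= m.+1 -> A \subset prefix p ->
  #|gap_pairings q (p |: A)| = #|gap_pairings p A| * npairings (q - p.+1).
Proof.
move=> pq qm sA; have ltA x : x \in A -> x < p by move=> /(subsetP sA); rewrite inE.
pose S2 := prefix q :\: prefix p.+1.
have cS2 : #|S2| = q - p.+1.
  rewrite cardsD (setIidPr _) ?card_prefix_set //.
  by apply/subsetP => x; rewrite !inE => /leq_trans; apply.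
have disj : [disjoint prefix p :\: A & S2].
  rewrite -setI_eq0; apply/eqP/setP => x; rewrite !inE; lia.
have SU : prefix p :\: A :|: S2 = prefix q :\: (p |: A).
  apply/setP => x; rewrite !inE -val_eqE /=.
  have [/ltA|] := boolP (x \in A); lia.
have sub1 : gap_pairings p A \subset pairings (prefix p :\: A).
  by apply/subsetP => N; rewrite inE => /andP[].
rewrite -cS2 -card_pairings -(card_pairingsU disj sub1 (subxx _)).
apply: eq_card => N; rewrite inE -SU.
apply/andP/imset2P => [[pN /avoidsP av]|[N1 N2]]; last first.
  rewrite inE => /andP[p1 /avoidsP av1] p2 ->; split; first exact: pairingsU.
  have in1 (d : {set 'I_m.+1}) x : d \in N1 -> x \in d -> x < p.
    by move=> /(pairings_chord_sub p1)/subsetP h /h; rewrite !inE => /andP[].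
  have in2 (d : {set 'I_m.+1}) x : d \in N2 -> x \in d -> p < x.
    by move=> /(pairings_chord_sub p2)/subsetP h /h; rewrite !inE; lia.
  apply/avoidsP => d w1 w2 x; rewrite !inE => /orP[] dN w1d w2d /orP[/eqP->|xA] l1 l2.
  - by have := in1 _ _ dN w2d; lia.
  - exact: av1 dN w1d w2d xA l1 l2.
  - by have := in2 _ _ dN w1d; lia.
  - by have := in2 _ _ dN w1d; have := ltA _ xA; lia.
have notp (d : {set 'I_m.+1}) x : d \in N -> x \in d -> x != p.
  move=> /(pairings_chord_sub pN)/subsetP h /h; rewrite SU !inE.
  by case: (x == p).
have side (d : {set 'I_m.+1}) x y : d \in N -> x \in d -> y \in d -> x < p -> y < p.
  move=> dN xd yd xp; have := notp _ _ dN yd; rewrite -val_eqE /= neq_ltn => /orP[//|py].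
  by case: (av d x y p dN xd yd _ xp py); rewrite !inE eqxx.
pose N1 := [set d in N | d \subset prefix p].
have sN1 : N1 \subset N by apply/subsetP => d; rewrite inE => /andP[].
have cov1 : cover N1 = prefix p :\: A.
  apply/setP => x; apply/bigcupP/idP => [[d]|xS].
    rewrite inE => /andP[dN /subsetP dp] xd.
    have := subsetP (pairings_chord_sub pN dN) x xd; rewrite inE => /orP[//|].
    by have := dp x xd; rewrite !inE; lia.
  have [d dN xd] : exists2 d, d \in N & x \in d.
    by apply/bigcupP; rewrite -/(cover N) (pairings_cover pN) inE xS.
  exists d => //; rewrite inE dN; apply/subsetP => y yd; rewrite inE.
  by apply: side dN xd yd _; move: xS; rewrite !inE => /andP[].
exists N1 (N :\: N1).
- rewrite inE -{1}cov1 (pairings_sub pN sN1) /=.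
  apply/avoidsP => d w1 w2 x /(subsetP sN1) dN w1d w2d xA.
  by apply: av dN w1d w2d _; rewrite inE xA orbT.
- by have := pairingsD pN sN1; rewrite cov1 (setUDl disj).
- by rewrite -{1}(setID N N1) (setIidPr sN1).
Qed.

(* The point 0 is required to lie in [A], so that there is no gap before [A]. *)
Definition gap_sets q r := [set A : {set 'I_m.+1} |
  [&& A \subset prefix q, #|A| == r & (0 < q) ==> (ord0 \in A)]].

Definition gap_count q r := \sum_(A in gap_sets q r) #|gap_pairings q A|.

Lemma gap_count0 q : q <= m.+1 -> gap_count q 0 = (q == 0).
Proof.
move=> qm; rewrite /gap_count; case: q qm => [|q] qm; last first.
  rewrite big_pred0 // => A; rewrite inE cards_eq0 andbA.
  by have [->|] := eqVneq A set0; rewrite ?inE !(andbF, andbT).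
rewrite (big_pred1 set0) => [|A]; last first.
  rewrite inE cards_eq0 andbT /=; apply/andP/eqP => [[_ /eqP]//|->].
  by rewrite sub0set.
have -> : gap_pairings 0 set0 = [set set0]; last by rewrite cards1.
have P0 : prefix 0 :\: set0 = set0 by apply/setP => x; rewrite !inE.
apply/setP => N; rewrite /gap_pairings P0 !inE; apply/andP/eqP => [[pN _]|->].
  apply/setP => d; rewrite inE; apply/negP => dN.
  have := pairings_neq0 pN dN; rewrite -subset0.
  by rewrite (pairings_chord_sub pN).
split; last by apply/avoidsP => d; rewrite inE.
apply/pairingsP; split=> [|c d x|c]; rewrite ?inE //.
by rewrite /cover big_set0.
Qed.

(** Deleting the largest point [p] of the set also frees its last gap, the [q - p.+1] points that
    follow [p]. *)
Lemma gap_countS q r : q <= m.+1 ->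
  gap_count q r.+1 = \sum_(p < q) gap_count p r * npairings (q - p.+1).
Proof.
(* [ord0] is the default of the maximum; it belongs to every set in [gap_sets q r.+1]. *)
move=> qm; pose maxA A : 'I_m.+1 := [arg max_(i > ord0 in A) nat_of_ord i].
have maxAP A : ord0 \in A -> (maxA A \in A) /\ (forall x, x \in A -> x <= maxA A).
  by move=> A0; rewrite /maxA; case: arg_maxnP.
have gap0 A : A \in gap_sets q r.+1 -> ord0 \in A.
  rewrite inE => /and3P[/subsetP sA /eqP cA].
  have /card_gt0P[x /sA] : 0 < #|A| by rewrite cA.
  by rewrite inE => xq; rewrite (leq_ltn_trans _ xq).
rewrite /gap_count (partition_big maxA (fun p => p < q)) /=; last first.
  move=> A gA; have [+ _] := maxAP _ (gap0 _ gA).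
  by move: gA; rewrite inE => /and3P[/subsetP sA _ _] /sA; rewrite inE.
rewrite (big_ord_widen m.+1 (fun p => (\sum_(A in gap_sets p r) #|gap_pairings p A|)
  * npairings (q - p.+1))) //.
apply: eq_bigr => p pq.
rewrite (reindex_onto (fun A => p |: A) (fun A => A :\ p)) => [|A /andP[gA /eqP <-]]; last first.
  by rewrite setD1K //; have [] := maxAP _ (gap0 _ gA).
rewrite big_distrl /=; apply: eq_big => [A|A].
  apply/idP/idP => [/andP[/andP[gA /eqP mA] /eqP AE]|].
    have [_ ltp] := maxAP _ (gap0 _ gA); rewrite mA in ltp.
    have pA : p \notin A by rewrite -AE !inE eqxx.
    move: gA; rewrite !inE => /and3P[_ cA zA]; apply/and3P; split.
    - apply/subsetP => x xA; rewrite inE ltn_neqAle ltp ?inE ?xA ?orbT // andbT.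
      by apply: contraNneq pA => /val_inj <-.
    - by move: cA; rewrite cardsU1 pA.
    - apply/implyP => p0; move: zA; rewrite (leq_ltn_trans _ pq) //= => /orP[/eqP e|//].
      by move: p0; rewrite -e.
  rewrite inE => /and3P[/subsetP sA /eqP cA zA].
  have pA : p \notin A by apply/negP => /sA; rewrite inE ltnn.
  have gA : p |: A \in gap_sets q r.+1.
    rewrite inE cardsU1 pA cA add1n eqxx /=; apply/andP; split.
      by apply/subsetP => x; rewrite !inE => /orP[/eqP->//|/sA]; rewrite inE => /ltn_trans; apply.
    (* For [p = 0] the required point 0 is [p] itself, which is why [gap_sets] waives its condition
       when [q = 0]. *)
    apply/implyP => _; rewrite !inE; have [p0|p0] := posnP p.
      by rewrite (_ : ord0 = p) ?eqxx //; apply: val_inj.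
    by move: zA; rewrite p0 /= => ->; rewrite orbT.
  rewrite gA setU1K // eqxx andbT /=; apply/eqP.
  have [mA lem] := maxAP _ (gap0 _ gA); apply: val_inj; apply/eqP; rewrite eqn_leq /=.
  rewrite lem ?setU11 // andbT.
  by move: mA; rewrite !inE => /orP[/eqP->//|/sA]; rewrite inE => /ltnW.
move=> /andP[/andP[gA /eqP mA] /eqP AE]; apply: card_gap_pairingsU1 => //.
have [_ ltp] := maxAP _ (gap0 _ gA); rewrite mA in ltp.
have pA : p \notin A by rewrite -AE !inE eqxx.
apply/subsetP => x xA; rewrite inE ltn_neqAle ltp ?inE ?xA ?orbT // andbT.
by apply: contraNneq pA => /val_inj <-.
Qed.

(** If the component of 0 covers [A], then by [noncross_avoids] the rest is any filling of the gaps
    of [A]. *)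
Lemma npairings_gaps :
  npairings m.+1 = \sum_(r < m.+2) nconnected r * gap_count m.+1 r.
Proof.
rewrite (npairings_root _ noncross_separable).
have prefixT : prefix m.+1 = [set: 'I_m.+1] by apply/setP => x; rewrite !inE ltn_ord.
have le A : #|A| < m.+2 by rewrite ltnS -[X in _ <= X](card_ord m.+1) max_card.
rewrite (partition_big (fun A => inord #|A| : 'I_m.+2) xpredT) //=.
apply: eq_bigr => r _; rewrite big_distrr /=; apply: eq_big => [A|A /andP[A0 /eqP <-]].
  by rewrite inE prefixT subsetT -val_eqE /= inordK // andbC.
rewrite inordK // /nconnected -(card_primitives _ noncross_invariant) -cardsX.
apply: eq_card => -[N1 N2]; rewrite !inE /= prefixT setTD.
have [p1|] //= := boolP (N1 \in pairings A).
have [p2|] := boolP (N2 \in pairings (~: A)); last by rewrite andbF.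
have [pr1|] //= := boolP (primitive _ N1).
by rewrite (@noncross_avoids _ A N1 N2 ord0).
Qed.

End Gaps.

(** * Series by number of points *)

Section PairingSeries.
Local Open Scope ring_scope.

Definition pairing_series : fps := fun m => (npairings m)%:R.
Definition connected_series : fps := fun m => (nconnected m)%:R.
Definition two_connected_series : fps := fun m => (ntwo_connected m)%:R.
Definition indec_series : fps := fun m => (nindec m)%:R.

(** Each point of the set brings itself and the gap on its right, hence one factor
    [fps_X * pairing_series]. *)
Lemma gap_count_series m q r : (q <= m.+1)%N ->
  (gap_count m q r)%:R = ((fps_X * pairing_series) ^+ r) q :> rat.
Proof.
elim: r q => [|r IH] q qm; first by rewrite gap_count0.
rewrite gap_countS // natr_sum exprS mulrAC -mulrA coef_fpsXM.
case: q qm => [|q] qm; first by rewrite big_ord0.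
rewrite coef_fpsM; apply: eq_bigr => p _.
by rewrite subSS natrM IH // ltnW // (leq_trans (ltn_ord p)).
Qed.

Lemma pairing_series_connected :
  pairing_series = 1 + fps_comp connected_series (fps_X * pairing_series).
Proof.
apply/fpsP => -[|m].
  by rewrite coef_fpsD coef0_fps_comp /connected_series /nconnected nprimitives0
    addr0 /pairing_series npairings0.
rewrite coef_fpsD add0r {1}/pairing_series npairings_gaps natr_sum.
(* The range of [r] is exactly that of the truncated sum defining [fps_comp]. *)
by apply: eq_bigr => r _; rewrite natrM gap_count_series.
Qed.

Lemma pairing_series_indec : pairing_series = 1 + indec_series * pairing_series.
Proof.
have i0 : indec_series 0%N = 0 by rewrite /indec_series /nindec nprimitives0.
apply/fpsP => -[|m].
  by rewrite coef_fpsD coef0_fpsM i0 mul0r addr0 /pairing_series npairings0.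
rewrite coef_fpsD add0r {1}/pairing_series npairings_indec natr_sum.
rewrite coef_fpsM [RHS]big_ord_recl /= i0 mul0r add0r.
by apply: eq_bigr => p _; rewrite /indec_series natrM /bump /= add1n subSS.
Qed.

Lemma pairing_series_ode :
  pairing_series = 1 + fps_X ^+ 2 * (pairing_series + fps_theta pairing_series).
Proof.
apply/fpsP => -[|[|m]]; rewrite coef_fpsD expr2 -mulrA !coef_fpsXM.
- by rewrite addr0 /pairing_series npairings0.
- by rewrite addr0 /pairing_series npairings_odd.
- by rewrite coef_fpsD /fps_theta /pairing_series npairingsSS natrM add0r -natr1; ring.
Qed.

(** The factor [m - l] of [ntwo_connectedE] is the size of the component through 0, whence
    [fps_theta]. *)
Lemma two_connected_seriesE :
  two_connected_series = fps_theta connected_series * connected_series.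
Proof.
apply/fpsP => m; rewrite mulrC coef_fpsM big_ord_recr /= subnn /fps_theta mul0r mulr0 addr0.
rewrite /two_connected_series ntwo_connectedE natr_sum; apply: eq_bigr => l _.
by rewrite !natrM /connected_series; ring.
Qed.

(** With Y = x D, the differential equation reads D - 1 = x theta(Y). As theta(Y) is the factor on
    the right of the chain rule, the product of (theta C)(Y) and C(Y) = D - 1 is obtained without
    division. *)
Lemma le2_series_comp :
  fps_comp (1 + connected_series + two_connected_series) (fps_X * pairing_series)
  = (1 - fps_X ^+ 2) * pairing_series ^+ 2.
Proof.
set D := pairing_series; set Y := fps_X * D.
have Y0 : Y 0%N = 0 by rewrite /Y coef0_fpsM mul0r.
have compC : fps_comp connected_series Y = D - 1.
  by rewrite {1}/D pairing_series_connected addrC addKr.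
have DE : D - 1 = fps_X ^+ 2 * (D + fps_theta D).
  by rewrite {1}/D pairing_series_ode addrC addKr.
have chain := fps_theta_comp connected_series Y0.
rewrite compC fps_thetaB fps_theta1 subr0 /Y fps_thetaM fps_thetaX in chain.
rewrite two_connected_seriesE !fps_compD fps_compM // fps_comp1 compC.
set E := fps_comp (fps_theta connected_series) Y in chain *.
have -> : E * (D - 1) = fps_theta D * (fps_X * D) * fps_X.
  by rewrite chain DE; ring.
have -> : fps_theta D * (fps_X * D) * fps_X = D * (D - 1 - fps_X ^+ 2 * D).
  by rewrite DE; ring.
ring.
Qed.

End PairingSeries.

(** * Components and concatenation of chord diagrams *)

Lemma diagram_pairings n (M : diagram n) : val M \in pairings [set: 'I_n.*2].
Proof. by rewrite mem_pairings; apply: valP M. Qed.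

Lemma pairings_diagram n (N : {set {set 'I_n.*2}}) :
  N \in pairings [set: 'I_n.*2] -> exists M : diagram n, val M = N.
Proof.
by rewrite mem_pairings => dN; exists (exist (@is_diagram n) N dN).
Qed.

Lemma card_diagrams n (P : pred {set {set 'I_n.*2}}) :
  #|[pred M : diagram n | P (val M)]| = #|[set N in pairings [set: 'I_n.*2] | P N]|.
Proof.
rewrite -(card_imset _ val_inj); apply: eq_card => N.
rewrite [RHS]inE; apply/imsetP/andP => [[M PM ->]|[/pairings_diagram[M <-] PM]].
  by rewrite diagram_pairings.
by exists M.
Qed.

Section Components.
Variables (n : nat) (M : diagram n).
Notation e := (intersection_graph (M := M)).
Notation N := (val M).
Notation sep := (separated (@noncross n.*2)).
Notation prim := (primitive (@noncross n.*2)).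

Lemma intersection_graph_sym : connect_sym e.
Proof. by apply: sym_connect_sym => c d; apply: cross_sym. Qed.

Definition component_set (x : chord M) : {set {set 'I_n.*2}} :=
  [set val y | y in [pred y | connect e x y]].

Lemma mem_component_set x (y : chord M) : (val y \in component_set x) = connect e x y.
Proof. by rewrite mem_imset //; apply: val_inj. Qed.

Lemma chordP (c : {set 'I_n.*2}) : reflect (exists x : chord M, val x = c) (c \in N).
Proof.
by apply: (iffP idP) => [cN|[x <-]]; [exists (exist _ c cN) | apply: (valP x)].
Qed.

Lemma component_set_sub x : component_set x \subset N.
Proof. by apply/subsetP => _ /imsetP[y _ ->]; apply: (valP y). Qed.

Lemma component_set_separated x : sep N (component_set x).
Proof.
apply/separatedP; split=> [|_ d /imsetP[y xy ->] /chordP[z <-]].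
  exact: component_set_sub.
rewrite mem_component_set => xz; apply: contra xz => yz.
by rewrite inE in xy; apply: connect_trans xy (connect1 (yz : e y z)).
Qed.

Lemma separated_connect K (x y : chord M) : sep N K -> connect e x y ->
  val x \in K -> val y \in K.
Proof.
move=> /separatedP[sK hK] xy.
suff cl : closed e [pred z : chord M | val z \in K].
  by have := closed_connect cl xy; rewrite !inE => ->.
apply: (intro_closed intersection_graph_sym) => {xy}x {}y xy; rewrite !inE => xK.
by apply: contraTT xy => yK; apply: hK => //; apply: (valP y).
Qed.

Lemma component_set_primitive x : prim (component_set x).
Proof.
apply/primitiveP; split=> [|K sK].
  by apply/set0Pn; exists (val x); rewrite mem_component_set connect0.
have [sKx _] := separatedP _ _ _ sK.
have sKN := separated_trans (component_set_separated x) sK.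
have [->|/set0Pn[c cK]] := eqVneq K set0; [by left | right].
have /imsetP[y + cE] := subsetP sKx c cK; rewrite inE => xy.
apply/eqP; rewrite eqEsubset sKx; apply/subsetP => _ /imsetP[z + ->]; rewrite inE => xz.
apply: (@separated_connect K y) => //; last by rewrite -cE.
by apply: connect_trans xz; rewrite intersection_graph_sym.
Qed.

Lemma primitive_component_set K x : sep N K -> prim K -> val x \in K ->
  K = component_set x.
Proof.
move=> sK pK xK; apply: (primitive_inj sK (component_set_separated x) pK) xK _.
  exact: component_set_primitive.
by rewrite mem_component_set connect0.
Qed.

(** Components are the separated primitive subsets and are counted by their canonical roots; the
    three cases are zero, one and two components. *)
Lemma components_le2 :
  (components M <= 2) = [|| N == set0, prim N | two_connected N].
Proof.
have rootsE : components M = #|[set x | roots e x]|.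
  by rewrite /components /n_comp_mem cardsE; apply: eq_card => x; rewrite !inE andbT.
have root_in x : fingraph.root e x \in [set x | roots e x].
  by rewrite inE fingraph.roots_root //; apply: intersection_graph_sym.
have sNN : sep N N by apply/separatedP; split=> // c d _ ->.
rewrite rootsE; apply/idP/idP => [le2|/or3P[/eqP N0|pN|/existsP[K /and3P[sK pK pNK]]]].
- have [//|/set0Pn[c0 /chordP[x _]]] := eqVneq N set0.
  have [Nx|Nx] := eqVneq N (component_set x).
    by rewrite Nx component_set_primitive.
  have [y xy] : exists y, ~~ connect e x y.
    case: (pickP [pred y | ~~ connect e x y]) => [y xy|xN]; first by exists y.
    case/negP: Nx.
    rewrite eqEsubset component_set_sub andbT; apply/subsetP => _ /chordP[z <-].
    by rewrite mem_component_set; have /negbFE := xN z.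
  (* These two roots are distinct, so the bound leaves no room for a third component. *)
  have roots2 : [set fingraph.root e x; fingraph.root e y] = [set x | roots e x].
    apply/eqP; rewrite eqEcard cards2 root_connect ?xy; last exact: intersection_graph_sym.
    by rewrite le2 andbT; apply/subsetP => z; rewrite in_set2 => /orP[]/eqP->.
  apply/or3P; apply: Or33; apply/existsP; exists (component_set x).
  rewrite component_set_separated component_set_primitive /=.
  suff -> : N :\: component_set x = component_set y by apply: component_set_primitive.
  apply/setP => c; apply/setDP/idP => [[/chordP[z <-]]|cy].
    rewrite !mem_component_set => xz; have := root_in z; rewrite -roots2 in_set2.
    rewrite !(sameP eqP (fingraph.rootP intersection_graph_sym)).
    by rewrite !(intersection_graph_sym z) (negPf xz).
  have /chordP[z zE] := subsetP (component_set_sub y) c cy; subst c.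
  split; first exact: (valP z).
  move: cy; rewrite !mem_component_set => yz; apply: contra xy => xz.
  by apply: connect_trans xz _; rewrite intersection_graph_sym.
- rewrite (_ : [set x | roots e x] = set0) ?cards0 //; apply/setP => x.
  have xN : val x \in N := valP x.
  by move/setP/(_ (val x)): N0; rewrite xN in_set0.
- have /primitiveP[/set0Pn[c0 /chordP[x _]] _] := pN.
  have Nx := primitive_component_set sNN pN (valP x).
  apply: leq_trans (_ : #|[set fingraph.root e x]| <= 2); last by rewrite cards1.
  apply/subset_leq_card/subsetP => z; rewrite !inE => /eqP <-.
  apply/eqP/(fingraph.rootP intersection_graph_sym); rewrite intersection_graph_sym.
  by rewrite -mem_component_set -Nx; apply: (valP z).
- have [sKN _] := separatedP _ _ _ sK.
  have /primitiveP[/set0Pn[c cK] _] := pK; have /primitiveP[/set0Pn[d dNK] _] := pNK.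
  have /chordP[x xE] := subsetP sKN c cK; have /chordP[y yE] := subsetP (subsetDl _ _) d dNK.
  subst c d.
  have Kx := primitive_component_set sK pK cK.
  have Ky := primitive_component_set (separated_noncrossD sK) pNK dNK.
  apply: leq_trans (_ : #|[set fingraph.root e x; fingraph.root e y]| <= 2); last by rewrite cards2; case: eqP.
  apply/subset_leq_card/subsetP => z; rewrite !inE => /eqP <-.
  rewrite !(sameP eqP (fingraph.rootP intersection_graph_sym)) !(intersection_graph_sym z).
  rewrite -!mem_component_set -Kx -Ky inE (valP z) andbT.
  exact: orbN.
Qed.

End Components.

(** The three cases of [components_le2] exclude one another. *)
Lemma card_le2 n : #|[pred M : diagram n | components M <= 2]| =
  (n == 0) + nconnected n.*2 + ntwo_connected n.*2.
Proof.
pose P (N : {set {set 'I_n.*2}}) :=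
  [|| N == set0, primitive (@noncross n.*2) N | two_connected N].
transitivity #|[pred M : diagram n | P (val M)]|.
  by apply: eq_card => M; rewrite !inE components_le2.
rewrite card_diagrams /nconnected /nprimitives /ntwo_connected.
have -> : nat_of_bool (n == 0) = #|[set N in pairings [set: 'I_n.*2] | N == set0]|.
  case: n {P} => [|n] /=.
    rewrite (_ : [set N in _ | _] = [set set0]) ?cards1 //.
    apply/setP => N; rewrite !inE; case: eqVneq => [->|]; rewrite ?andbF ?andbT //.
    apply/pairingsP; split=> [|c d x|c]; rewrite ?inE //.
    by apply/setP => -[].
  apply/esym/eqP; rewrite cards_eq0; apply/eqP/setP => N; rewrite !inE.
  apply/negP => /andP[pN /eqP N0]; have := pairings_cover pN.
  rewrite N0 /cover big_set0 => /setP/(_ (@Ordinal n.+1.*2 0 isT)).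
  by rewrite !inE.
have nprim0 (N : {set {set 'I_n.*2}}) : primitive (@noncross n.*2) N -> N != set0.
  by case/primitiveP.
have two0 (N : {set {set 'I_n.*2}}) : two_connected N -> (N != set0) && ~~ primitive (@noncross n.*2) N.
  case/existsP => K /and3P[sK pK pNK]; have [sKN _] := separatedP _ _ _ sK.
  have /set0Pn[c cK] := nprim0 _ pK; have /set0Pn[d] := nprim0 _ pNK.
  rewrite inE => /andP[dK dN]; apply/andP; split; first by apply/set0Pn; exists d.
  apply/negP => /primitiveP[_ pN]; have [K0|KN] := pN K sK.
    by rewrite K0 inE in cK.
  by rewrite KN dN in dK.
rewrite -!sum1_card !(big_mkcond (fun N => N \in _)) -!big_split /=.
apply: eq_bigr => N _; rewrite !inE; case: (N \in pairings _) => //=.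
rewrite /P; have [->|N0] /= := eqVneq N set0.
  case: ifP => [/nprim0|_]; rewrite ?eqxx //.
  by case: ifP => [/two0/andP[]|]; rewrite ?eqxx.
case: ifP => [/orP[p|/[dup] t /two0/andP[_ /negPf->]]|/norP[/negPf-> /negPf->]] //.
  by rewrite p; case: ifP => // /two0/andP[_]; rewrite p.
by rewrite t.
Qed.

Section Concatenation.

(** Sizes such as [n + 0] and [n] are equal but not convertible, so diagrams are compared through a
    cast of their points. *)
Lemma existT_diagram n n' (eqn : n = n') (M : diagram n) (M' : diagram n') :
  val M' = map_chords (cast_ord (congr1 double eqn)) (val M) ->
  existT _ n M = existT (fun n => diagram n) n' M'.
Proof.
subst n' => e; congr existT; apply: val_inj; rewrite /= e.
rewrite /map_chords (eq_imset (g := id)) ?imset_id // => c.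
by rewrite (eq_imset (g := id)) ?imset_id // => i; apply: val_inj.
Qed.

Lemma concat_empty n (M : diagram n) :
  existT (fun n => diagram n) (n + 0) (concat M empty_diagram) = existT _ n M.
Proof.
apply/esym/(existT_diagram (eqn := esym (addn0 n))); rewrite /= /concat_set /=.
rewrite [X in _ :|: X](_ : _ = set0) ?setU0; last first.
  by apply/setP => c; rewrite inE; apply/imsetP => -[d]; rewrite inE.
by apply: eq_imset => c; apply: eq_imset => i; apply: val_inj.
Qed.

Lemma concat_not_primitive m n (D : diagram m) (E : diagram n) : 0 < m -> 0 < n ->
  ~~ primitive (@before (m + n).*2) (val (concat D E)).
Proof.
have nonempty k (F : diagram k) : 0 < k -> exists c, c \in val F.
  case: k F => // k F _.
  have : Ordinal (isT : 0 < k.+1.*2) \in cover (val F).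
    by rewrite (pairings_cover (diagram_pairings F)) inE.
  by case/bigcupP => c; exists c.
move=> /(nonempty _ D)[c cD] /(nonempty _ E)[d dE].
pose K := [set point_left n @: c | c : {set 'I_m.*2} in val D].
apply/negP => /primitiveP[_ /(_ K)[]].
- apply/separatedP; split=> [|_ e /imsetP[c' c'D ->]]; first exact: subsetUl.
  rewrite inE => /orP[->//|/imsetP[d' d'E ->] _].
  apply/beforeP => _ _ /imsetP[i _ ->] /imsetP[j _ ->] /=.
  by rewrite ltn_addr.
- move/setP/(_ (point_left n @: c)); rewrite inE.
  by rewrite imset_f.
move/setP/(_ (point_right m @: d)); rewrite [RHS]inE (imset_f _ dE) orbT.
case/imsetP => c' _ e.
have /set0Pn[j jd] := pairings_neq0 (diagram_pairings E) dE.
have : point_right m j \in point_left n @: c' by rewrite -e imset_f.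
by case/imsetP => i _ /esym/point_left_right.
Qed.

Lemma concat_decomposition m n (M : diagram (m + n)) (K : {set {set 'I_(m + n).*2}}) :
  K \subset val M -> cover K = prefix_set (m + n).*2 m.*2 ->
  exists (D : diagram m) (E : diagram n), M = concat D E.
Proof.
move=> sK covK.
have leftE : prefix_set (m + n).*2 m.*2 = [set point_left n i | i in [set: 'I_m.*2]].
  apply/setP => i; rewrite inE; have [[j ->]|[j ->]] := point_split i.
    by rewrite imset_f ?inE //; exact: (ltn_ord j).
  rewrite /= ltnNge leq_addr; apply/esym/imsetP => -[k _ /esym].
  exact: point_left_right.
have rightE : ~: prefix_set (m + n).*2 m.*2 = [set point_right m i | i in [set: 'I_n.*2]].
  apply/setP => i; rewrite !inE -leqNgt; have [[j ->]|[j ->]] := point_split i.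
    rewrite /= leqNgt ltn_ord; apply/esym/imsetP => -[k _].
    exact: point_left_right.
  by rewrite imset_f ?inE //; apply: leq_addr.
have pM := diagram_pairings M.
have := pairings_sub pM sK; rewrite covK leftE pairings_imset; last exact: point_left_inj.
case/imsetP => _ /pairings_diagram[D <-] KE.
have := pairingsD pM sK; rewrite covK setTD rightE pairings_imset; last exact: point_right_inj.
case/imsetP => _ /pairings_diagram[E <-] KE'.
exists D, E; apply: val_inj; rewrite /= /concat_set -[LHS](setID _ K) (setIidPr sK) KE'.
by rewrite {1}KE.
Qed.

(** A list of at least two factors is read as its first factor against the rest; conversely a proper
    nonempty separated set is the first of two factors. At [n = 0] the equivalence fails: the empty
    diagram is indecomposable but not primitive. *)
Lemma indecomposable_primitive n (M : diagram n) : 0 < n ->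
  indecomposable M <-> primitive (@before n.*2) (val M).
Proof.
move=> n0; split=> [ind|pM [[|D [|E s]] [//= _ /and3P[D0 E0 _] e]]]; last first.
  (* A predicate on dependent pairs lets [e] be rewritten without casting sizes. *)
  pose P (F : {n & diagram n}) := ~~ primitive (@before (tag F).*2) (val (tagged F)).
  have : P (existT _ n M) by rewrite -e; apply: concat_not_primitive; rewrite ?addn_gt0 ?E0.
  by rewrite /P /= pM.
apply/negPn/negP => npM; apply: ind.
have pM := diagram_pairings M; have cov := pairings_cover pM.
have M0 : val M != set0.
  apply/eqP => M0; have := card_pairings_points pM; rewrite M0 cards0 cardsT card_ord.
  by move/eqP; rewrite double_eq0 => /eqP n0'; rewrite n0' in n0.
have [K sK /andP[K0 KM]] :
    exists2 K, separated (@before n.*2) (val M) K & (K != set0) && (K != val M).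
  move: npM; rewrite /primitive M0 negb_forall => /existsP[K].
  by rewrite negb_imply negb_or => /andP[sK KP]; exists K.
have [sKM _] := separatedP _ _ _ sK.
have /andP[_ compat] := sK.
have pK := pairings_sub pM sKM; have pK' := pairingsD pM sKM; rewrite setTD in pK'.
have cK := card_pairings_points pK; have cK' := card_pairings_points pK'.
rewrite (before_initial pK pK') initial_prefix cK in compat.
have nE : n = #|K| + #|val M :\: K|.
  by apply: double_inj; rewrite doubleD -cK -cK' cardsC card_ord.
have k0 : 0 < #|K| by rewrite card_gt0.
have l0 : 0 < #|val M :\: K|.
  by rewrite card_gt0 setD_eq0; apply: contra KM => sMK; rewrite eqEsubset sKM.
move: #|K| #|val M :\: K| nE k0 l0 compat => k l nE k0 l0 /eqP covK.
clear - k0 l0 covK sKM nE; subst n.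
have [D [E ->]] := concat_decomposition sKM covK.
exists [:: existT _ k D; existT _ l E]; split=> //=; first by rewrite k0 l0.
by rewrite (congr1 (fun F => existT (fun n => diagram n) (k + tag F)
  (concat D (tagged F))) (concat_empty E)).
Qed.

End Concatenation.

Lemma I0E n : I0 n = (nindec n.*2)%:R%R.
Proof.
congr (_%:R)%R; case: n => [|n].
  by rewrite /nindec nprimitives0; apply: eq_card0 => M; rewrite inE.
transitivity #|[pred M : diagram n.+1 | primitive (@before n.+1.*2) (val M)]|.
  apply: eq_card => M; rewrite !inE /=; apply/asboolP/idP; first by move/indecomposable_primitive->.
  by move=> pM; apply/indecomposable_primitive.
by rewrite card_diagrams.
Qed.

(** * From series by points to series by chords, and the tree equation *)

Section FunctionalEquations.
Local Open Scope ring_scope.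
Implicit Types f g h : fps.

Lemma coef_fps_comp_X2 f n :
  fps_comp f (fps_X ^+ 2) n = if odd n then 0 else f n./2.
Proof.
rewrite /fps_comp; under eq_bigr => k _ do rewrite -exprM fps_X_exp mulr_natr mulrb.
rewrite -big_mkcond /=; case: ifP => n_odd.
  rewrite big_pred0 // => k; apply/negbTE; apply: contraTneq (n_odd) => ->.
  by rewrite mul2n odd_double.
have n2 : (n./2 < n.+1)%N by lia.
rewrite (big_pred1 (Ordinal n2)) // => k; rewrite /= -val_eqE /=; lia.
Qed.

Lemma fps_comp_X2_inj f g :
  fps_comp f (fps_X ^+ 2) = fps_comp g (fps_X ^+ 2) -> f = g.
Proof.
move=> e; apply/fpsP => n; have := congr1 (fun h : fps => h n.*2) e.
by rewrite /= !coef_fps_comp_X2 odd_double doubleK.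
Qed.

Definition diagram_series : fps := fun n => #|diagram n|%:R.
Definition le2_series : fps := fun n => #|[pred M : diagram n | (components M <= 2)%N]|%:R.
Definition marked_series : fps := fps_X * diagram_series ^+ 2.

Lemma diagram_series_X2 : fps_comp diagram_series (fps_X ^+ 2) = pairing_series.
Proof.
apply/fpsP => n; rewrite coef_fps_comp_X2 /pairing_series.
case: ifP => [/npairings_odd->//|/negbT n_even].
rewrite -{2}(even_halfK n_even) /diagram_series /npairings; congr _%:R.
transitivity #|[pred M : diagram n./2 | predT (val M)]|; first by [].
by rewrite card_diagrams; apply: eq_card => N; rewrite inE andbT.
Qed.

Lemma le2_series_X2 : fps_comp le2_series (fps_X ^+ 2) =
  1 + connected_series + two_connected_series.
Proof.
apply/fpsP => n; rewrite coef_fps_comp_X2 !coef_fpsD /connected_series /two_connected_series.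
case: ifP => [n_odd|/negbT n_even].
  have := npairings_odd n_odd; have := nprimitives_le noncross n => le /eqP n0.
  have {}le : nconnected n = 0%N by apply/eqP; rewrite -leqn0 -(eqP n0).
  have -> : ntwo_connected n = 0%N.
    apply/eqP; rewrite -leqn0 -(eqP n0) subset_leq_card //.
    by apply/subsetP => N; rewrite inE => /andP[].
  by rewrite le; case: n n_odd {n0 le}.
rewrite /le2_series card_le2 even_halfK // !natrD coef_fps1.
by congr (_%:R + _ + _); case: n n_even => [|[|n]].
Qed.

Lemma fps_X2_0 : (fps_X ^+ 2) 0%N = 0. Proof. by rewrite fps_X_exp. Qed.

Lemma marked_series0 : marked_series 0%N = 0.
Proof. by rewrite /marked_series coef_fpsXM. Qed.

Lemma le2_series_marked :
  fps_comp le2_series marked_series = (1 - fps_X) * diagram_series ^+ 2.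
Proof.
have compX2 := fps_compX fps_X2_0; have X20 := fps_X2_0.
set Y := fps_X * pairing_series.
have Y0 : Y 0%N = 0 by rewrite /Y coef_fpsXM.
(* Both sides equal [Y ^+ 2], so the two substitutions can be exchanged. *)
have YE : fps_comp marked_series (fps_X ^+ 2) = fps_comp (fps_X ^+ 2) Y.
  rewrite fps_compM // compX2 !fps_compXe // diagram_series_X2 fps_compX // exprMn.
  by [].
apply: fps_comp_X2_inj; rewrite fps_compA ?marked_series0 // YE -fps_compA //.
rewrite le2_series_X2 le2_series_comp fps_compM // fps_compXe // diagram_series_X2.
by rewrite fps_compD fps_compN fps_comp1 compX2.
Qed.

Lemma diagram_series_inv : diagram_series * (1 - I0) = 1.
Proof.
apply: fps_comp_X2_inj; rewrite fps_compM ?fps_X2_0 // fps_compD fps_compN !fps_comp1.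
have -> : fps_comp I0 (fps_X ^+ 2) = indec_series.
  apply/fpsP => n; rewrite coef_fps_comp_X2 /indec_series.
  case: ifP => [n_odd|/negbT n_even]; last by rewrite I0E even_halfK.
  have := nprimitives_le before n; rewrite npairings_odd // leqn0 => /eqP.
  by rewrite /nindec => ->.
by rewrite diagram_series_X2 mulrBr mulr1 {1}pairing_series_indec mulrC addrK.
Qed.

(** The series x / (1 - x) of nonempty linear orders, whose number cancels the factorial. *)
Definition blocks_series : fps := fun n => (0 < n)%:R.

Lemma blocks_seriesE : blocks_series * (1 - fps_X) = fps_X.
Proof.
rewrite mulrC mulrBl mul1r; apply/fpsP => -[|[|n]]; rewrite coef_fpsB coef_fpsXM //.
Qed.

(* The inverse of [blocks_series] for composition, x / (1 + x). *)
Definition unblock_series : fps := fun n => if n is m.+1 then (-1) ^+ m else 0.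

Lemma unblock_seriesE : unblock_series * (1 + fps_X) = fps_X.
Proof.
rewrite mulrC mulrDl mul1r; apply/fpsP => -[|[|n]]; rewrite coef_fpsD coef_fpsXM //.
- by rewrite /= exprS mulN1r addNr.
Qed.

Lemma unblock_blocks : fps_comp unblock_series blocks_series = fps_X.
Proof.
have q0 : blocks_series 0%N = 0 by [].
have := congr1 (fps_comp^~ blocks_series) unblock_seriesE.
rewrite /= fps_compM // fps_compD fps_comp1 fps_compX // => e.
have q1 : (1 + blocks_series) * (1 - fps_X) = 1 by rewrite mulrDl blocks_seriesE mul1r subrK.
by rewrite -[LHS]mulr1 -q1 mulrA e blocks_seriesE.
Qed.

Lemma blocks_unblock : fps_comp blocks_series unblock_series = fps_X.
Proof.
have p0 : unblock_series 0%N = 0 by [].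
have := congr1 (fps_comp^~ unblock_series) blocks_seriesE.
rewrite /= fps_compM // fps_compD fps_compN fps_comp1 fps_compX // => e.
have p1 : (1 - unblock_series) * (1 + fps_X) = 1.
  by rewrite mulrBl unblock_seriesE mul1r addrK.
by rewrite -[LHS]mulr1 -p1 mulrA e unblock_seriesE.
Qed.

Definition tree_series := fps_comp marked_series unblock_series.

Lemma marked_seriesE :
  marked_series = blocks_series * fps_comp le2_series marked_series.
Proof. by rewrite le2_series_marked mulrA blocks_seriesE. Qed.

(** Substituting x / (1 + x) into [marked_seriesE] turns its factor x / (1 - x) into x. *)
Lemma tree_seriesE : tree_series = fps_X * fps_comp le2_series tree_series.
Proof.
have p0 : unblock_series 0%N = 0 by [].
rewrite {1}/tree_series marked_seriesE fps_compM // blocks_unblock.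
by rewrite fps_compA ?marked_series0.
Qed.

Lemma tree_series_blocks : fps_comp tree_series blocks_series = marked_series.
Proof. by rewrite fps_compA // unblock_blocks fps_compfX. Qed.

End FunctionalEquations.

(** * Labelled classes *)

Lemma card_tagged_sum (I : finType) (T_ : I -> finType) :
  #|{: {i : I & T_ i}}| = \sum_i #|T_ i|.
Proof. by rewrite card_tagged sumnE big_map big_enum. Qed.

Lemma card_dffun (I : finType) (T_ : I -> finType) :
  #|{: {dffun forall i : I, T_ i}}| = \prod_i #|T_ i|.
Proof. by rewrite card_dep_ffun foldrE big_image. Qed.

Lemma big_sig (R : Type) (idx : R) (op : Monoid.com_law idx) (I : finType)
    (P : pred I) (F : I -> R) :
  \big[op/idx]_(i | P i) F i = \big[op/idx]_(x : {x | P x}) F (val x).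
Proof.
rewrite (reindex_omap (val : {x | P x} -> I) insub) => [|i Pi]; last by rewrite insubT.
by apply: eq_bigl => x; rewrite valK eqxx (valP x).
Qed.

Lemma card_elt (T : finType) (S : {set T}) : #|elt S| = #|S|.
Proof. by rewrite card_sig; apply: eq_card => x; rewrite inE. Qed.

Lemma card_bijections (aT rT : finType) : #|aT| = #|rT| ->
  #|{: {f : {ffun aT -> rT} | bijectiveb f}}| = #|rT|`!.
Proof.
move=> e; rewrite card_sig -ffactnn -{2}e -card_inj_ffuns.
apply: eq_card => f; rewrite !inE /bijectiveb; apply: andb_idr => /injectiveP f_inj.
by apply/forallP => y; apply: (inj_card_onto f_inj); rewrite e.
Qed.

(** * Linear orders as rankings *)

Section LinearOrders.
Variable E : finType.
Implicit Types (r : {set E * E}) (f : {ffun E -> 'I_#|E|}).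

Definition order_of f : {set E * E} := [set p : E * E | f p.1 <= f p.2].

(** Lets the ranking be read off the order it induces; [f] is onto, so every value below [f x] is
    attained. *)
Lemma rank_order_of (f : {ffun E -> 'I_#|E|}) x : injective f -> #|[set y | f y < f x]| = f x.
Proof.
move=> f_inj; rewrite -(card_imset _ f_inj) -[RHS](card_prefix_set (ltnW (ltn_ord (f x)))).
apply: eq_card => i; rewrite inE; apply/imsetP/idP => [[y + ->]|lt_i]; first by rewrite inE.
have /codomP[y e] : i \in codom f by apply: (inj_card_onto f_inj); rewrite card_ord.
by exists y; rewrite // inE -e.
Qed.

Lemma order_of_inj (f g : {ffun E -> 'I_#|E|}) : injective f -> injective g -> order_of f = order_of g -> f = g.
Proof.
move=> f_inj g_inj /setP e; apply/ffunP => x; apply: val_inj.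
rewrite /= -(rank_order_of _ f_inj) -(rank_order_of _ g_inj); apply: eq_card => y.
by have := e (x, y); rewrite !inE /= !ltnNge => ->.
Qed.

Lemma order_of_linear (f : {ffun E -> 'I_#|E|}) : injective f -> is_linear_order (order_of f).
Proof.
move=> f_inj; apply/and4P; split.
- by apply/forallP => x; rewrite inE.
- apply/forallP => x; apply/forallP => y; rewrite !inE /=.
  by apply/implyP; rewrite -eqn_leq => /eqP/val_inj/f_inj->.
- apply/forallP => x; apply/forallP => y; apply/forallP => z; rewrite !inE /=.
  by apply/implyP => /andP[]; apply: leq_trans.
- by apply/forallP => x; apply/forallP => y; rewrite !inE /= leq_total.
Qed.

Lemma linear_order_of r : is_linear_order r ->
  exists2 f : {ffun E -> 'I_#|E|}, injective f & r = order_of f.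
Proof.
case/and4P => /forallP refl /forallP anti /forallP trans /forallP total.
(* The number of elements below [x] is the rank to be given to [x]. *)
pose below x := [set y | ((y, x) \in r) && (y != x)].
have below_lt x : #|below x| < #|E|.
  rewrite -cardsT; apply/proper_card/properP; split; first exact: subsetT.
  by exists x; rewrite !inE ?eqxx ?andbF.
have mono x y : (x, y) \in r -> x != y -> #|below x| < #|below y|.
  move=> rxy xy; apply/proper_card/properP; split; last first.
    by exists x; rewrite !inE ?eqxx ?andbF // rxy xy.
  apply/subsetP => z; rewrite !inE => /andP[rzx zx].
  have /forallP/(_ x)/forallP/(_ y) := trans z; rewrite rzx rxy /= => ->.
  apply: contraNneq xy => zy; rewrite zy in rzx.
  by have /forallP/(_ y)/implyP := anti x; apply; rewrite rxy rzx.
exists [ffun x => Ordinal (below_lt x)].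
  move=> x y /(congr1 val); rewrite !ffunE /= => e; apply/eqP; apply: contraT => xy.
  have /forallP/(_ y)/orP[/mono/(_ xy)|/mono] := total x; first by rewrite e ltnn.
  by rewrite eq_sym e ltnn => /(_ xy).
apply/setP => -[x y]; rewrite inE !ffunE /=.
have [->|xy] := eqVneq x y; first by rewrite leqnn refl.
apply/idP/idP => [/mono/(_ xy)/ltnW//|]; apply: contraTT => rxy.
have /forallP/(_ y) := total x; rewrite (negPf rxy) /= => ryx.
by rewrite -ltnNge mono // eq_sym.
Qed.

Lemma card_linear_orders : #|[pred r : {set E * E} | is_linear_order r]| = #|E|`!.
Proof.
have -> : #|E|`! = #|[set f : {ffun E -> 'I_#|E|} | injectiveb f]|.
  by rewrite card_inj_ffuns card_ord ffactnn.
rewrite -(card_in_imset (f := order_of)).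
  apply: eq_card => r; rewrite inE; apply/idP/imsetP => [/linear_order_of[f f_inj ->]|[f + ->]].
    by exists f; rewrite // inE; apply/injectiveP.
  by rewrite inE => /injectiveP/order_of_linear.
by move=> f g; rewrite !inE => /injectiveP ? /injectiveP ?; apply: order_of_inj.
Qed.

End LinearOrders.

(** * Exponential series of classes *)

Section ExponentialSeries.
Local Open Scope ring_scope.

(** Asked for all label sets, not only [[set: 'I_n]]: products and trees evaluate classes on
    arbitrary finite sets, and an [lclass] carries no transport along bijections. *)
Definition has_egf (A : lclass) (a : fps) :=
  forall (T : finType) (S : {set T}), #|A T S|%:R = (#|S|)`!%:R * a #|S| :> rat.

Lemma fact_neq0 n : n`!%:R != 0 :> rat.
Proof. by rewrite Num.Theory.pnatr_eq0 -lt0n fact_gt0. Qed.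

Lemma has_egfP A a : has_egf A a -> egf A = a.
Proof.
move=> hA; apply/fpsP => n; rewrite /egf hA cardsT card_ord mulrC mulKf //.
exact: fact_neq0.
Qed.

(** Subsets of size k are counted by a binomial, which absorbs the factorials. It is stated for
    functions rather than classes, as [forest_sumE] applies it to a [b] built from the sizes at
    hand. *)
Lemma sum_subsets (T : finType) (S : {set T}) (a b : fps) :
  \sum_(A : {set T} | A \subset S)
    ((#|A|)`!%:R * a #|A|) * ((#|S :\: A|)`!%:R * b #|S :\: A|)
  = (#|S|)`!%:R * (a * b) #|S|.
Proof.
have le (A : {set T}) : A \subset S -> (#|A| < #|S|.+1)%N.
  by move=> AS; rewrite ltnS subset_leq_card.
rewrite (partition_big (fun A : {set T} => inord #|A| : 'I_#|S|.+1) predT) //=.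
rewrite coef_fpsM mulr_sumr; apply: eq_bigr => k _.
rewrite (eq_bigr (fun=> (k`!%:R * a k) * ((#|S| - k)`!%:R * b (#|S| - k)%N))); last first.
  move=> A /andP[AS /eqP <-]; rewrite inordK ?le //.
  by rewrite cardsD (setIidPr AS).
rewrite sumr_const -(bin_fact (_ : k <= #|S|)%N) -1?ltnS // !natrM.
have -> : #|[pred A : {set T} | A \subset S & inord #|A| == k]| = 'C(#|S|, k).
  rewrite -cards_draws; apply: eq_card => A; rewrite !inE.
  by case: (boolP (A \subset S)) => //= AS; rewrite -val_eqE /= inordK ?le.
rewrite -mulr_natl; ring.
Qed.

Lemma has_egf_prod A B a b : has_egf A a -> has_egf B b -> has_egf (lprod A B) (a * b).
Proof.
move=> hA hB T S; rewrite -sum_subsets /lprod card_tagged_sum natr_sum.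
rewrite [RHS]big_sig; apply: eq_bigr => S1 _.
by rewrite card_prod natrM hA hB.
Qed.

Lemma has_egf_atom : has_egf atom_class fps_X.
Proof.
move=> T S; rewrite /atom_class card_sig /fps_X.
have [/eqP/cards1P[x ->]|S1] := eqVneq #|S| 1%N.
  rewrite cards1 mul1r (_ : #|_| = 1%N) //; rewrite -(card1 x); apply: eq_card => y.
  by rewrite !inE (inj_eq set1_inj) eq_sym.
rewrite mulr0 (_ : #|_| = 0%N) //; apply: eq_card0 => x; rewrite inE.
by apply: contra_neqF S1 => /eqP->; rewrite cards1.
Qed.

Lemma card_chord n (M : diagram n) : #|chord M| = n.
Proof.
rewrite card_sig; apply: double_inj; rewrite -[RHS]card_ord -cardsT.
by rewrite (card_pairings_points (diagram_pairings M)).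
Qed.

Lemma has_egf_diagram_class (G : forall n, pred (diagram n)) :
  has_egf (diagram_class G) (fun n => #|[pred M | @G n M]|%:R).
Proof.
move=> T S; rewrite /diagram_class card_tagged_sum -natrM mulnC -card_sig.
rewrite (eq_bigr (fun=> (#|S|)`!)) ?sum_nat_const // => M _.
by rewrite card_bijections card_elt // card_chord.
Qed.

Lemma has_egf_marked : has_egf (lprod atom_class (lprod D_class D_class)) marked_series.
Proof.
have hD : has_egf D_class diagram_series.
  move=> T S; rewrite (has_egf_diagram_class _ S).
  by congr (_ * _%:R); apply: eq_card.
by rewrite /marked_series expr2; apply/has_egf_prod/has_egf_prod => //; apply: has_egf_atom.
Qed.

Lemma has_egf_le2 : has_egf D_le2_class le2_series.
Proof. by move=> T S; rewrite (has_egf_diagram_class _ S). Qed.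

Section Partitions.
Variable T : finType.
Implicit Types (S b : {set T}) (P : {set {set T}}).

(** The number of partitions into [m] blocks with a linear order on each block. *)
Definition partition_sum m S : rat :=
  \sum_(P : {set {set T}} | partition P S && (#|P| == m)) \prod_(b in P) (#|b|)`!%:R.

(* Both sides count partitions with a marked block. *)
Lemma partition_sumS m S : m.+1%:R * partition_sum m.+1 S =
  \sum_(b : {set T} | b \subset S)
    ((#|b|)`!%:R * blocks_series #|b|) * partition_sum m (S :\: b).
Proof.
transitivity (\sum_(P : {set {set T}} | partition P S && (#|P| == m.+1))
    \sum_(b | b \in P) \prod_(b in P) (#|b|)`!%:R : rat).
  rewrite mulr_sumr; apply: eq_bigr => P /andP[_ /eqP cP].
  by rewrite sumr_const cP mulr_natl.
rewrite (exchange_big_dep (fun b => (b \subset S) && (b != set0))) /=; last first.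
  move=> P b /andP[/and3P[/eqP<- _ P0] _] bP; rewrite bigcup_sup //=.
  by apply: contraNneq P0 => <-.
rewrite big_mkcondr; apply: eq_bigr => b bS; rewrite /blocks_series card_gt0.
case: eqVneq => [_|b0] /=; first by rewrite mulr0 mul0r.
rewrite mulr1 /partition_sum mulr_sumr.
rewrite (reindex_onto (fun P => b |: P) (fun P => P :\ b)) => [|P /andP[_ bP]]; last exact: setD1K.
apply: eq_big => [P|P].
  apply/idP/idP => [/andP[/andP[/andP[pP cP] bP] /eqP e]|/andP[pP cP]].
    rewrite -e (partitionD1 pP bP) /=.
    by move: cP; rewrite (cardsD1 b) bP.
  have bP : b \notin P.
    by apply: contra b0 => /(partitionS pP); rewrite subsetD -setI_eq0 setIid => /andP[].
  have disj : [disjoint b & S :\: b] by rewrite -setI_eq0 setIDA setDIl setDv set0I.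
  have SE : b :|: S :\: b = S by rewrite -{1}(setIidPr bS) setID.
  have := partitionU1 pP b0 disj; rewrite SE => ->.
  by rewrite setU1K // eqxx setU11 cardsU1 bP add1n eqSS cP.
move=> /andP[_ /eqP e]; rewrite big_setU1 //.
by rewrite -e !inE eqxx.
Qed.

(** The factor m! arranges the blocks in a sequence, and sequences of [m] nonempty ordered sets have
    series [blocks_series ^+ m]. *)
Lemma partition_sumE m S :
  m`!%:R * partition_sum m S = (#|S|)`!%:R * (blocks_series ^+ m) #|S|.
Proof.
elim: m S => [|m IH] S.
  rewrite mul1r expr0 coef_fps1 cards_eq0 /partition_sum.
  rewrite (eq_bigl (fun P => (P == set0) && (S == set0))) => [|P]; last first.
    rewrite cards_eq0; have [->|] := eqVneq P set0; rewrite ?andbF ?andbT //.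
    by rewrite /partition /trivIset /cover !big_set0 cards0 inE !andbT eq_sym.
  have [->|_] := eqVneq S set0; last by rewrite big_pred0 ?mulr0 // => P; rewrite andbF.
  by rewrite (big_pred1 set0) ?big_set0 ?cards0 ?mulr1 // => P; rewrite andbT.
rewrite factS natrM [_ * m`!%:R]mulrC -mulrA partition_sumS mulr_sumr exprS -sum_subsets.
by apply: eq_bigr => b _; rewrite mulrCA IH.
Qed.

End Partitions.
End ExponentialSeries.

(** * Weighted rooted forests *)

Section Forests.
Local Open Scope ring_scope.
Variable V : finType.
Implicit Types (R S U K : {set V}) (f : {ffun V -> V}).

(* [f] is the parent function of a forest with set of roots [R] and set of
   other vertices [S]; outside of [S] it is the identity. *)
Definition forest R S f :=
  [&& [forall u, (u \notin S) ==> (f u == u)], [forall u in S, f u \in R :|: S]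
    & [forall K : {set V}, (K \subset S) && [forall u in K, f u \in K] ==> (K == set0)]].

Lemma forestP R S f : reflect
  [/\ forall u, u \notin S -> f u = u, forall u, u \in S -> f u \in R :|: S
    & forall K : {set V}, K \subset S -> (forall u, u \in K -> f u \in K) -> K = set0]
  (forest R S f).
Proof.
apply: (iffP and3P) => [[/forallP f1 /forall_inP f2 /forallP f3]|[f1 f2 f3]]; split=> //.
- by move=> u uS; apply/eqP; have /implyP := f1 u; apply.
- move=> K KS Kf; apply/eqP; have /implyP := f3 K; apply; rewrite KS.
  exact/forall_inP.
- by apply/forallP => u; apply/implyP => uS; rewrite f1.
- exact/forall_inP.
- by apply/forallP => K; apply/implyP => /andP[KS /forall_inP Kf]; rewrite (f3 K KS Kf).
Qed.

Definition sons S f v := [set u in S | f u == v].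

Variables (phi : fps) (W : fps).
Hypothesis WE : W = fps_X * fps_comp phi W.

(** When [phi] is the exponential series of a class, the number of its structures on [k]
    children. *)
Definition weight k : rat := k`!%:R * phi k.

Definition forest_sum R S : rat :=
  \sum_(f | forest R S f) \prod_(v in R :|: S) weight #|sons S f v|.

Lemma forest_series0 : W 0%N = 0. Proof. by rewrite WE coef_fpsXM. Qed.

(** One factor W is replaced by x phi(W): deleting a root with [k] children leaves [r + k] roots.
    Terms with [k > s] vanish by valuation. *)
Lemma coef_tree_expS r s : (W ^+ r.+1) (r.+1 + s)%N =
  \sum_(k < s.+1) phi k * (W ^+ (r + k)) (r + s)%N.
Proof.
have W0 := forest_series0.
rewrite exprS {1}WE -mulrA addSn coef_fpsXM coef_fpsM.
transitivity (\sum_(k < (r + s).+1) phi k * (W ^+ (r + k)) (r + s)%N).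
  transitivity (\sum_(i < (r + s).+1) \sum_(k < (r + s).+1)
      phi k * ((W ^+ k) i * (W ^+ r) (r + s - i)%N)).
    apply: eq_bigr => i _; rewrite (@fps_compE (r + s).+1) // mulr_suml.
    by apply: eq_bigr => k _; rewrite mulrA.
  rewrite exchange_big; apply: eq_bigr => k _ /=.
  by rewrite -mulr_sumr (addnC r k) exprD.
rewrite -(big_mkord xpredT (fun k => phi k * (W ^+ (r + k)) (r + s)%N)).
rewrite (big_cat_nat (n := s.+1)) //= ?ltnS ?leq_addl // big_mkord.
rewrite [X in _ + X]big_nat [X in _ + X]big1 ?addr0 // => k /andP[sk _].
by rewrite coef_fpsX_lt ?mulr0 // ltn_add2l.
Qed.

(** Deleting the root [r0] promotes its children [U] to roots. [detach] fixes them because a parent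
    function is the identity on roots. *)
Lemma forest_sum_root R S (r0 : V) (U : {set V}) : r0 \in R -> [disjoint R & S] ->
  U \subset S ->
  \sum_(f | forest R S f && (sons S f r0 == U)) \prod_(v in R :|: S) weight #|sons S f v|
  = weight #|U| * forest_sum (R :\ r0 :|: U) (S :\: U).
Proof.
move=> r0R dis US; have r0S : r0 \notin S by rewrite (disjointFr dis r0R).
have US' u : u \in U -> u \in S by move/(subsetP US).
pose attach (f : {ffun V -> V}) : {ffun V -> V} := [ffun u => if u \in U then r0 else f u].
pose detach (f : {ffun V -> V}) : {ffun V -> V} := [ffun u => if u \in U then u else f u].
have r0U : r0 \notin U by apply: contra r0S => /US'.
have attachK f : forest R S f && (sons S f r0 == U) -> attach (detach f) = f.
  move=> /andP[_ /eqP sU]; apply/ffunP => u; rewrite !ffunE; case: ifP => [|->//].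
  by rewrite -sU inE => /andP[_ /eqP].
have condE f : (forest R S (attach f) && (sons S (attach f) r0 == U)) &&
    (detach (attach f) == f) = forest (R :\ r0 :|: U) (S :\: U) f.
  apply/idP/idP => [/andP[/andP[/forestP[f1 f2 f3] /eqP sU] /eqP fK]|/forestP[f1 f2 f3]].
    have fU u : u \in U -> f u = u by move=> uU; rewrite -fK !ffunE uU.
    have attE u : u \notin U -> attach f u = f u by move=> /negPf uU; rewrite ffunE uU.
    have fr0 u : u \in S -> u \notin U -> f u != r0.
      move=> uS uU; have aE := attE u uU; apply: contraNneq uU => e.
      by rewrite -sU inE uS aE e eqxx.
    apply/forestP; split=> [u|u|K KS Kf].
    - rewrite inE negb_and negbK; have [/fU//|uU /= uS] := boolP (u \in U).
      by rewrite -attE // f1.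
    - rewrite inE => /andP[uU uS]; have := f2 u uS; rewrite attE // !inE fr0 //=.
      by case: (f u \in U); rewrite ?orbT ?orbF.
    - apply: f3 => [|u uK]; first by apply: subset_trans KS (subsetDl _ _).
      by have := subsetP KS u uK; rewrite inE => /andP[uU _]; rewrite attE // Kf.
  have fU u : u \in U -> f u = u by move=> uU; rewrite f1 // inE uU.
  have attE u : u \notin U -> attach f u = f u by move=> /negPf uU; rewrite ffunE uU.
  have attU u : u \in U -> attach f u = r0 by move=> uU; rewrite ffunE uU.
  have fS u : u \in S -> u \notin U -> (f u \in R :|: S) && (f u != r0).
    move=> uS uU; have := f2 u; rewrite !inE uU uS => /(_ isT).
    case/orP => [/orP[/andP[-> ->]//|/[dup] fuU /US' fuS]|/andP[_ fuS]].
      by rewrite fuS orbT; apply: contraNneq r0S => <-.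
    by rewrite fuS orbT; apply: contraNneq r0S => <-.
  apply/andP; split; [apply/andP; split|].
  - apply/forestP; split=> [u uS|u uS|K KS Kf].
    + have uU : u \notin U by apply: contra uS => /US'.
      by rewrite attE // f1 // inE (negPf uS) andbF.
    + have [uU|uU] := boolP (u \in U); first by rewrite attU // inE r0R.
      by rewrite attE //; have /andP[] := fS u uS uU.
    (* A stable [K] cannot meet [U], or it would contain [r0], which is outside [S]. *)
    + have KU u : u \in K -> u \notin U.
        move=> uK; apply/negP => uU; have := Kf u uK; rewrite attU //.
        by move/(subsetP KS); rewrite (negPf r0S).
      apply: f3 => [|u uK]; last by rewrite -attE ?KU // Kf.
      by apply/subsetP => u uK; rewrite inE KU // (subsetP KS).
  - apply/eqP/setP => u; rewrite inE; have [uU|uU] := boolP (u \in U).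
      by rewrite attU // US' // eqxx.
    by apply/andP => -[uS]; rewrite attE //; have /andP[_ /negPf->] := fS u uS uU.
  - apply/eqP/ffunP => u; rewrite !ffunE.
    by have [uU|//] := boolP (u \in U); rewrite fU.
rewrite (reindex_onto attach detach) //= (eq_bigl _ _ condE) /forest_sum mulr_sumr.
apply: eq_bigr => f; rewrite -condE => /andP[/andP[ff /eqP sU] /eqP fK].
rewrite (bigD1 r0) ?inE ?r0R //= sU; congr (_ * _).
apply: eq_big => [v|v /andP[_ vr0]].
  rewrite !inE; have [->|vr0] := eqVneq v r0; first by rewrite (negPf r0S) (negPf r0U) /= !andbF.
  have [vU|_] := boolP (v \in U); last by rewrite orbF andbT.
  by rewrite US' // !orbT.
congr weight; apply: eq_card => u; rewrite !inE !ffunE.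
by have [uU|] := boolP (u \in U); rewrite //= eq_sym (negPf vr0) andbF.
Qed.

(** Without roots, [S] itself is stable under the parent function, hence empty. *)
Lemma forest_sum0 S : forest_sum set0 S = (S == set0)%:R.
Proof.
rewrite /forest_sum set0U; have [->|S0] := eqVneq S set0.
  rewrite (big_pred1 [ffun u => u]) ?big_set0 // => f; apply/forestP/eqP => [[f1 _ _]|->].
    by apply/ffunP => u; rewrite ffunE f1 ?inE.
  split=> [u _|u|K]; rewrite ?ffunE ?inE // subset0 => /eqP->; by [].
rewrite big_pred0 // => f; apply/forestP => -[_ f2 f3]; case/eqP: S0.
by apply: f3 => // u /f2; rewrite set0U.
Qed.

(** Induction on the number of vertices: [forest_sum_root] and [coef_tree_expS] give both sides the
    same recursion. *)
Lemma forest_sumE R S : [disjoint R & S] ->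
  forest_sum R S = (#|S|)`!%:R * (W ^+ #|R|) (#|R| + #|S|)%N.
Proof.
move: {2}(#|R| + #|S|)%N (leqnn (#|R| + #|S|)%N) => n.
elim: n R S => [|n IH] R S le_n dis; have [R0|[r0 r0R]] := set_0Vmem R.
- by rewrite R0 forest_sum0 cards0 expr0 coef_fps1 -cards_eq0; case: #|S| => // k; rewrite mulr0.
- by move: le_n; rewrite (cardsD1 r0 R) r0R.
- by rewrite R0 forest_sum0 cards0 expr0 coef_fps1 -cards_eq0; case: #|S| => // k; rewrite mulr0.
rewrite /forest_sum (partition_big (fun f => sons S f r0) (fun U => U \subset S)) /=; last first.
  by move=> f _; apply/subsetP => u; rewrite inE => /andP[].
have cR : #|R| = #|R :\ r0|.+1 by rewrite (cardsD1 r0 R) r0R.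
rewrite cR in le_n *; set r := #|R :\ r0| in le_n *; set s := #|S| in le_n *.
(* [#|U|] is written [s - #|S :\: U|] in the exponent so that this factor depends only on the
   complement, as [sum_subsets] requires. *)
rewrite (eq_bigr (fun U : {set V} => ((#|U|)`!%:R * phi #|U|) *
   ((#|S :\: U|)`!%:R * (W ^+ (r + (s - #|S :\: U|)))%R (r + s)%N))) => [|U US]; last first.
  have disU : [disjoint R :\ r0 & U].
    apply/pred0P => u /=; apply/negP => /andP[/setD1P[_ uR] /(subsetP US)].
    by rewrite (disjointFr dis uR).
  have cRU : #|R :\ r0 :|: U| = (r + #|U|)%N.
    by rewrite cardsU disjoint_setI0 // cards0 subn0.
  have leU : (#|U| <= s)%N := subset_leq_card US.
  have cSU : #|S :\: U| = (s - #|U|)%N by rewrite cardsD (setIidPr US).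
  have sE : (r + #|U| + (s - #|U|) = r + s)%N by rewrite -addnA subnKC.
  rewrite forest_sum_root // IH.
  + by rewrite cRU cSU subKn // sE.
  + by rewrite cRU cSU sE -ltnS -addSn.
  apply/pred0P => u /=; rewrite !inE; case: (u \in U); rewrite /= ?andbF //.
  by case: (boolP (u \in R)) => [/(disjointFr dis)->|_]; rewrite ?andbF.
rewrite (sum_subsets S phi (fun i => (W ^+ (r + (s - i)))%R (r + s)%N)) -/s.
rewrite coef_tree_expS; congr (_ * _); apply: eq_bigr => k _.
by rewrite subKn // -ltnS.
Qed.

(** The vertices that do not lead to [r] form a stable set of non-roots; conversely a stable set
    with a vertex leading to [r] contains [r]. *)
Lemma is_rooted_tree_forest (r : V) f :
  is_rooted_tree (r, f) = forest [set r] (~: [set r]) f.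
Proof.
apply/andP/forestP => /= [[/eqP fr /forallP conn]|[f1 f2 f3]].
  split=> [u|u _|K KS Kf]; first by rewrite !inE negbK => /eqP->.
    by rewrite setUCr inE.
  apply/setP => u; rewrite inE; apply/negP => uK.
  have : r \in K.
    rewrite -(iter_findex (conn u)); elim: (findex _ _ _) => //= i; exact: Kf.
  by move/(subsetP KS); rewrite !inE eqxx.
have fr : f r = r by rewrite f1 // !inE eqxx.
split; first by rewrite fr.
suff /setP K0 : [set v | ~~ fconnect f v r] = set0.
  by apply/forallP => v; have := K0 v; rewrite !inE => /negbFE.
apply: f3 => [|u].
  by apply/subsetP => v; rewrite !inE; apply: contraNneq => ->; apply: connect0.
rewrite !inE; apply: contra; apply: connect_trans.
by apply: connect1; rewrite /frel /= eqxx.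
Qed.

(** Any of the n vertices may be the root, and the others contribute (n - 1)!. *)
Lemma rooted_tree_sum :
  \sum_(t : rooted_tree V) \prod_v weight #|children t v| = (#|V|)`!%:R * W #|V|.
Proof.
transitivity (\sum_(t : V * {ffun V -> V} | is_rooted_tree t)
    \prod_v weight #|[set u | (u != t.1) && (t.2 u == v)]|).
  by rewrite [RHS]big_sig.
transitivity (\sum_r forest_sum [set r] (~: [set r])).
  rewrite (eq_bigl (fun t : V * {ffun V -> V} =>
    true && forest [set t.1] (~: [set t.1]) t.2)) => [|[r f]]; last first.
    by rewrite is_rooted_tree_forest.
  rewrite -(pair_big_dep xpredT (fun r f => forest [set r] (~: [set r]) f)
    (fun r f => \prod_v weight #|[set u | (u != r) && (f u == v)]|)) /=.
  apply: eq_bigr => r _; apply: eq_bigr => f _; rewrite setUCr.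
  apply: eq_big => [v|v _]; first by rewrite inE.
  by congr weight; apply: eq_card => u; rewrite !inE.
rewrite (eq_bigr (fun=> (#|V|.-1)`!%:R * W #|V|)) => [|r _]; last first.
  rewrite forest_sumE; last by rewrite -setI_eq0 setICr.
  have cr : #|~: [set r]| = #|V|.-1 by rewrite cardsCs setCK cards1 subn1.
  by rewrite cardsC cards1 expr1 cr.
rewrite sumr_const -[LHS]mulr_natl mulrA -natrM.
case: #|V| => [|k]; first by rewrite mul0n mul0r forest_series0 mulr0.
by rewrite -factS.
Qed.

End Forests.

(** * The series of the tree class and the bijection *)

Local Open Scope ring_scope.

(** The m! in the count of trees on [m] blocks turns partitions into sequences of blocks, so summing
    over partitions amounts to composing with [blocks_series]. *)
Lemma has_egf_Z : has_egf Z_class marked_series.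
Proof.
move=> T S; rewrite /Z_class card_tagged_sum natr_sum.
pose blocks (P : {set {set T}}) : rat := \prod_(b in P) (#|b|)`!%:R.
transitivity (\sum_(P : {set {set T}} | partition P S)
    blocks P * ((#|P|)`!%:R * tree_series #|P|)).
  rewrite [RHS]big_sig; apply: eq_bigr => P _.
  rewrite -card_elt -(rooted_tree_sum _ tree_seriesE) card_tagged_sum natr_sum mulr_sumr.
  apply: eq_bigr => t _; rewrite card_prod natrM !card_dffun !natr_prod.
  congr (_ * _).
    rewrite /blocks [RHS]big_sig; apply: eq_bigr => v _.
    by rewrite /linear_order card_sig card_linear_orders card_elt.
  by apply: eq_bigr => v _; rewrite has_egf_le2.
(* A crude common cutoff, above both the size of any family of blocks and the degree [#|S|]. *)
pose N := (#|{: {set T}}| + #|S|).+1.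
have ltN (P : {set {set T}}) : (#|P| < N)%N.
  by rewrite ltnS (leq_trans (max_card _)) // leq_addr.
rewrite -tree_series_blocks (@fps_compE N) ?ltnS ?leq_addl // mulr_sumr.
rewrite (partition_big (fun P : {set {set T}} => inord #|P| : 'I_N) xpredT) //=.
apply: eq_bigr => m _; rewrite mulrCA -partition_sumE mulrCA mulr_sumr mulr_sumr.
apply: eq_big => [P|P /andP[_ /eqP <-]]; first by rewrite -val_eqE /= inordK.
by rewrite inordK // mulrC mulrA.
Qed.

Lemma card_objects (A B : lclass) a : has_egf A a -> has_egf B a ->
  forall n, #|A 'I_n [set: 'I_n]| = #|B 'I_n [set: 'I_n]|.
Proof.
by move=> hA hB n; apply/eqP; rewrite -(Num.Theory.eqr_nat rat) hA hB.
Qed.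

Lemma objects_bijection (A B : lclass) :
  (forall n, #|A 'I_n [set: 'I_n]| = #|B 'I_n [set: 'I_n]|) ->
  exists Theta : objects A -> objects B,
    bijective Theta /\ forall z, osize (Theta z) = osize z.
Proof.
move=> e; pose F (C D : lclass) (eCD : forall n, #|C 'I_n [set: 'I_n]| = #|D 'I_n [set: 'I_n]|)
  (z : objects C) : objects D :=
  existT _ (tag z) (enum_val (cast_ord (eCD (tag z)) (enum_rank (tagged z)))).
exists (F _ _ e); split=> //; exists (F _ _ (fun n => esym (e n))) => -[n x];
  by rewrite /F /= enum_valK ?cast_ordK ?cast_ordKV enum_rankK.
Qed.

Lemma fps_invE (f g : fps) : f 0%N != 0 -> g * f = 1 -> fps_inv f = g.
Proof.
move=> f0 gf; have /fpsP fK := fps_mulVf f0.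
by rewrite -[LHS]mulr1 -gf mulrCA [_ * f]fK mulr1.
Qed.

Theorem theorem4p2 :
  (exists Theta : objects Z_class -> objects (lprod atom_class (lprod D_class D_class)),
      bijective Theta /\ forall z, osize (Theta z) = osize z)
  /\ egf Z_class =1
       fps_mul fps_X (fps_mul (fps_inv (fps_sub fps_one I0))
                              (fps_inv (fps_sub fps_one I0))).
Proof.
split; first exact/objects_bijection/(card_objects has_egf_Z has_egf_marked).
have I00 : (1 - I0 : fps) 0%N != 0.
  by rewrite coef_fpsB I0E /nindec nprimitives0 subr0.
apply/fpsP; rewrite (has_egfP has_egf_Z).
by rewrite [fps_sub _ _]/(1 - I0) (fps_invE I00 diagram_series_inv).
Qed.
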